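(* Let $q$ be a prime power and let $d$ be an integer with $2 \le d \le q$ and $(d,q) \neq (4,4)$. Let $\mathcal{X} \subset \mathbb{P}^4$ be a nonsingular threefold of degree $d$ defined over $\mathbb{F}_q$. Then $$|\mathcal{X}(\mathbb{F}_q)| \le (d-1)q^3 + (d-1)q^2 + q + 1.$$ Moreover, equality holds only if there exists a point $P \in \mathcal{X}(\mathbb{F}_q)$ such that $\mathcal{X} \cap T_P(\mathcal{X})$ is a cone, with center at $P$, over a plane curve $\mathcal{C}$ of degree $d$ defined over $\mathbb{F}_q$ that does not contain a line defined over $\mathbb{F}_q$ and satisfies $|\mathcal{C}(\mathbb{F}_q)| = (d-1)q + 1$.
   Context: $\mathbb{F}_q$ is the finite field with $q$ elements, $\overline{\mathbb{F}}_q$ a fixed algebraic closure, and $\mathbb{P}^m$ denotes the $m$-dimensional projective space over $\overline{\mathbb{F}}_q$. A threefold of degree $d$ in $\mathbb{P}^4$ defined over $\mathbb{F}_q$ is a hypersurface, i.e. the zero set $V(F)$ of a nonzero homogeneous polynomial $F \in \mathbb{F}_q[x_0,\dots,x_4]$ of degree $d$; it is nonsingular if $F$ and its first-order partial derivatives have no common zero in $\mathbb{P}^4$ (over $\overline{\mathbb{F}}_q$). $\mathcal{X}(\mathbb{F}_q)$ is the set of $\mathbb{F}_q$-rational points of $\mathcal{X}$, and $T_P(\mathcal{X})$ is the tangent hyperplane to $\mathcal{X}$ at $P$. The intersection $\mathcal{X}\cap T_P(\mathcal{X})$ is regarded as the surface of degree $d$ in $T_P(\mathcal{X}) \cong \mathbb{P}^3$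 defined by the restriction of $F$. The cone with center at $P$ over a plane curve $\mathcal{C}$ (lying in a plane of $T_P(\mathcal{X})$, defined over $\mathbb{F}_q$, not passing through $P$) is the union of the lines joining $P$ to the points of $\mathcal{C}$, with the equation induced from that of $\mathcal{C}$. A plane curve of degree $d$ defined over $\mathbb{F}_q$ is the zero set in a plane defined over $\mathbb{F}_q$ of a nonzero homogeneous polynomial of degree $d$ with coefficients in $\mathbb{F}_q$ (not necessarily irreducible). *)

(* Defs.v *)
From HB Require Import structures.
From mathcomp Require Import all_boot all_order all_algebra.
From mathcomp Require Export mpoly.

Set Implicit Arguments.
Unset Strict Implicit.
Unset Printing Implicit Defensive.

Import GRing.Theory.
Local Open Scope ring_scope.

(* A point of P^(n-1) is a nonzero row vector of length n up to scaling, and a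
   linear subspace is the row space of a matrix.  The hypersurface V(p) is
   represented by its equation p. *)

Section Hypersurface.

Variable n : nat.

Definition is_hypersurface (R : nzRingType) (d : nat) (p : {mpoly R[n]}) : bool :=
  (p != 0) && (p \is d.-homog).

Definition lies_on (R : comNzRingType) (p : {mpoly R[n]}) (v : 'rV[R]_n) : bool :=
  (v != 0) && (p.@[v 0] == 0).

(* [<<v>>%MS] depends only on the line spanned by v, so this counts each
   rational projective point once. *)
Definition rational_points (F : finFieldType) (p : {mpoly F[n]}) : {set 'M[F]_n} :=
  [set <<v>>%MS | v : 'rV[F]_n & lies_on p v].

Definition nonsingular (F K : fieldType) (iota : {rmorphism F -> K})
    (p : {mpoly F[n]}) : Prop :=
  ~ exists v : 'rV[K]_n,
      lies_on (map_mpoly iota p) v /\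
      forall i : 'I_n, (map_mpoly iota (mderiv i p)).@[v 0] = 0.

(* The rows of L span the line; containment is tested on points over K. *)
Definition contains_rational_line (F K : fieldType) (iota : {rmorphism F -> K})
    (p : {mpoly F[n]}) : Prop :=
  exists L : 'M[F]_(2, n), row_free L /\
    forall v : 'rV[K]_n, v != 0 -> (v <= map_mx iota L)%MS ->
      lies_on (map_mpoly iota p) v.

(* Row space: all x with \sum_i (dp/dx_i)(a) * x_i = 0. *)
Definition tangent_space (F : fieldType) (p : {mpoly F[n]}) (a : 'rV[F]_n) :
    'M[F]_n :=
  kermx (\col_i (mderiv i p).@[a 0]).

(* p restricted to the row space of M, in the coordinates y |-> y *m M. *)
Definition restrict (F : fieldType) (m : nat) (M : 'M[F]_(m, n))
    (p : {mpoly F[n]}) : {mpoly F[m]} :=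
  comp_mpoly [tuple \sum_(i < m) M i j *: 'X_i | j < n] p.

End Hypersurface.

(* Cone over V(g) with vertex (1 : 0 : ... : 0): the same equation, read in
   the variables other than the first. *)
Definition cone (F : fieldType) (m : nat) (g : {mpoly F[m]}) : {mpoly F[1 + m]} :=
  comp_mpoly [tuple 'X_(rshift 1 i) | i < m] g.

Definition same_hypersurface (F : fieldType) (m : nat) (p r : {mpoly F[m]}) : Prop :=
  exists2 c : F, c != 0 & p = c *: r.

(* The rows of B span the plane containing the base curve, and g is the
   equation of that curve in the coordinates given by these rows.  That a and
   the rows of B form a basis of the tangent space makes the plane lie in the
   tangent hyperplane and avoid the vertex a. *)
Definition tangent_section_is_cone_over (F : fieldType) (p : {mpoly F[5]})
    (a : 'rV[F]_5) (B : 'M[F]_(3, 5)) (g : {mpoly F[3]}) : Prop :=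
  [/\ row_free (col_mx a B),
      (col_mx a B == tangent_space p a)%MS
    & same_hypersurface (restrict (col_mx a B) p) (cone g)].

(* Main.v *)
Require Import Defs.
From HB Require Import structures.
From mathcomp Require Import all_boot all_order all_algebra.
From mathcomp Require Import zify ring.

(** Write d = r + 2 for the degree, q for the order of F, X for the threefold.
  The proof counts points along lines through a point and along planes through
  a line.

  If X contains no rational line, choose a rational point a.  A line through a
  meets X in at most d - 1 further points, and in at most d - 2 when it is
  tangent at a; summing over all lines through a gives strictly less than the
  bound ([no_line_points]).

  Otherwise fix a rational line L of X.  A nonsingular threefold contains no
  plane ([nonsingular_no_plane]): on a plane of X the two transverse derivatives
  are ternary forms of degree d - 1 >= 1, hence have a common zero
  ([plane_curves_meet]), which is a singular point.  So every plane through L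
  cuts X in L and a residual curve of degree d - 1, and the part of that curve
  off L is an affine curve with at most (d - 1) q points; the shortfall is the
  defect of the plane.  If no plane had a defect, X would have (d - 1) q points
  more than the bound, so everything comes down to showing that the defects of
  the q^2 + q + 1 planes add up to at least (d - 1) q ([points_defect]).

  A plane without defect ([full_plane]) has d - 1 parallel lines as its affine
  residual curve.  With L this makes d lines through one point e of L, and the
  form u |-> \sum_i w_i dp/dx_i (u) on L, where w points to the plane, is then
  a nonzero multiple of the (d - 1)-th power of the linear form vanishing at e.
  These forms depend linearly on w; the kernel of w |-> form, the polar space of
  L, has rank 2 or 3, because a pencil of proportional derivatives would vanish
  together at a point of L over the closure ([rank_polar_le]).

  If the polar space is L itself, too few planes can carry a pure power, and the
  remaining ones have total defect above (d - 1) q ([line_polar_defect]).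

  If the polar space is a plane, it has itself defect at least q, and the other
  planes fall into q + 1 families of q planes, the cosets of the polar space.  A
  family is either full, or loses at least max(1, d - 2) ([coset_defect]).  If
  no family is full, the total is at least (q + 1) max(1, d - 2) + q, above
  (d - 1) q.  If some family is full, all its planes are invariant under
  translation along the same e, a degree argument extends this to the polar
  plane ([full_coset_invariant]), and p is invariant under translation by e on
  the whole tangent space at e: the tangent section is a cone with vertex e.
  Its base curve has (d - 1) q + 1 rational points plus those coming from points
  of the polar plane off L.  When there are none, the bound and the description
  of equality follow.  When there are some, no other family can be full, and
  the defects still add up to (d - 1) q; equality is possible a priori only if
  the polar plane meets X in the double line L and d - 2 further lines through
  e ([tight]).  Replacing L by one of these further lines, along which the old
  polar plane is defective by q without being polar, rules this out
  ([tight_switch]).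

  Points are counted as vectors, so that each count of projective points
  appears multiplied by q - 1, and each count of planes through L by a power of
  q that records the choice of a representative. *)

Set Implicit Arguments.
Unset Strict Implicit.
Unset Printing Implicit Defensive.

Import GRing.Theory.
Local Open Scope ring_scope.

(** * Restriction of a form to a line *)

Lemma mpoly_alg_ind (n : nat) (R : comNzRingType) (P : {mpoly R[n]} -> Prop) :
  (forall c, P c%:MP) -> (forall i, P 'X_i) ->
  (forall f g, P f -> P g -> P (f + g)) ->
  (forall f g, P f -> P g -> P (f * g)) -> forall f, P f.
Proof.
move=> PC PX PD PM; elim/mpolyind; first by rewrite -mpolyC0.
move=> c m f _ _ Pf; apply: (PD) => //; rewrite -mul_mpolyC; apply: (PM) => //.
rewrite mpolyXE_id; apply: (big_ind P) => [||i _]; first by rewrite -mpolyC1.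
  exact: PM.
elim: (m i) => [|k IH]; first by rewrite expr0 -mpolyC1.
by rewrite exprS; apply: (PM).
Qed.

Lemma homog_ind (n : nat) (R : comNzRingType) (d : nat)
    (P : {mpoly R[n]} -> Prop) :
  P 0 -> (forall f g, P f -> P g -> P (f + g)) ->
  (forall c m, mdeg m = d -> P (c *: 'X_[m])) ->
  forall f, f \is d.-homog -> P f.
Proof.
move=> P0 PD PX f /dhomogP fh; rewrite [f]mpolyE big_seq.
by apply: (big_ind P) => // m /fh; apply: (PX).
Qed.

Lemma meval_map (n : nat) (R S : comNzRingType) (h : {rmorphism R -> S})
    (f : {mpoly R[n]}) (v : 'I_n -> S) :
  (map_mpoly h f).@[v] = mmap h v f.
Proof.
elim/mpoly_alg_ind: f => [c|i|f g IHf IHg|f g IHf IHg].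
- by rewrite map_mpolyC mevalC mmapC.
- by rewrite map_mpolyX mevalXU mmapX mmap1U.
- by rewrite !rmorphD /= IHf IHg.
- by rewrite !rmorphM /= IHf IHg.
Qed.

Lemma mmap_rmorph (n : nat) (R S T : comNzRingType) (h : {rmorphism R -> S})
    (k : {rmorphism S -> T}) (x : 'I_n -> S) (y : 'I_n -> T) f :
  (forall i, k (x i) = y i) -> k (mmap h x f) = mmap (k \o h) y f.
Proof.
move=> kx; elim/mpoly_alg_ind: f => [c|i|f g IHf IHg|f g IHf IHg].
- by rewrite !mmapC.
- by rewrite !mmapX !mmap1U kx.
- by rewrite !rmorphD /= IHf IHg.
- by rewrite !rmorphM /= IHf IHg.
Qed.

Lemma meval_rmorph (n : nat) (R S : comNzRingType) (h : {rmorphism R -> S})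
    (f : {mpoly R[n]}) (v : 'rV[R]_n) :
  (map_mpoly h f).@[map_mx h v 0] = h f.@[v 0].
Proof.
rewrite meval_map /meval.
by rewrite (@mmap_rmorph _ _ _ _ idfun h _ (map_mx h v 0)) // => i; rewrite mxE.
Qed.

Lemma dhomog_map (n : nat) (R S : comNzRingType) (h : {rmorphism R -> S}) d
    (f : {mpoly R[n]}) : f \is d.-homog -> map_mpoly h f \is d.-homog.
Proof.
elim/homog_ind => [|f' g Hf Hg|c m md]; first by rewrite rmorph0 dhomog0.
  by rewrite rmorphD /= dhomogD.
by rewrite map_mpolyZ map_mpolyX dhomogZ // dhomogX; apply/eqP.
Qed.

Lemma mderiv_map (n : nat) (R S : comNzRingType) (h : {rmorphism R -> S}) i
    (f : {mpoly R[n]}) : (map_mpoly h f)^`M(i) = map_mpoly h f^`M(i).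
Proof.
apply/mpolyP => m.
by rewrite mcoeff_mderiv !mcoeff_map_mpoly mcoeff_mderiv raddfMn.
Qed.

Lemma dhomog_mderiv (n : nat) (R : comNzRingType) d i (f : {mpoly R[n]}) :
  f \is d.+1.-homog -> f^`M(i) \is d.-homog.
Proof.
move=> /dhomogP fh; apply/dhomogP => m.
rewrite mcoeff_msupp mcoeff_mderiv => nz.
have /fh : (m + U_(i))%MM \in msupp f.
  by rewrite mcoeff_msupp; apply: contra_neq nz => ->; rewrite mul0rn.
by rewrite /= mdegD mdeg1 addn1 => -[].
Qed.

Section Line.

Variables (n : nat) (R : comNzRingType).
Implicit Types (f g : {mpoly R[n]}) (u v w : 'rV[R]_n).

Definition line_poly f u v : {poly R} :=
  mmap (@polyC R) (fun i => (u 0 i)%:P + v 0 i *: 'X) f.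

Definition dirder f w u : R := \sum_i w 0 i * (f^`M(i)).@[u 0].

Lemma line_polyD f g u v :
  line_poly (f + g) u v = line_poly f u v + line_poly g u v.
Proof. exact: rmorphD. Qed.

Lemma horner_line f u v s : (line_poly f u v).[s] = f.@[(u + s *: v) 0].
Proof.
rewrite -/(horner_eval s _).
rewrite (@mmap_rmorph _ _ _ _ _ (horner_eval s) _ ((u + s *: v) 0)).
  rewrite /meval; apply: eq_bigr => m _ /=.
  by rewrite /= horner_evalE hornerC.
by move=> i; rewrite /= horner_evalE !hornerE !mxE mulrC.
Qed.

Lemma meval_scale f d c u : f \is d.-homog -> f.@[(c *: u) 0] = c ^+ d * f.@[u 0].
Proof.
elim/homog_ind => [|f' g Hf Hg|a m md]; first by rewrite !meval0 mulr0.
  by rewrite !mevalD Hf Hg mulrDr.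
rewrite !mevalZ !mevalX mulrCA; congr (_ * _).
rewrite -md mdegE expr_sum -big_split /=; apply: eq_bigr => i _.
by rewrite mxE exprMn.
Qed.

Lemma meval_at0 f d : (0 < d)%N -> f \is d.-homog -> f.@[(0 : 'rV[R]_n) 0] = 0.
Proof.
by move=> d0 fh; rewrite -(scale0r (0:'rV_n)) (meval_scale _ _ fh) expr0n;
  case: d d0 {fh} => //= d _; rewrite mul0r.
Qed.

Lemma coefM_top (P Q : {poly R}) m k : (size P <= m.+1)%N -> (size Q <= k.+1)%N ->
  (P * Q)`_(m + k) = P`_m * Q`_k.
Proof.
move=> sP sQ; rewrite coefM.
have hm : (m < (m + k).+1)%N by rewrite ltnS leq_addr.
rewrite (bigD1 (Ordinal hm)) //= addKn big1 ?addr0 // => i /eqP ne.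
have [lt|gt|eq] := ltngtP i m.
- by rewrite [Q`__]nth_default ?mulr0 // (leq_trans sQ) // ltn_subRL ltn_add2r.
- by rewrite nth_default ?mul0r // (leq_trans sP).
- by case: ne; apply: val_inj.
Qed.

Definition has_top m (P : {poly R}) c := (size P <= m.+1)%N /\ P`_m = c.

Lemma has_topM m k P Q a b :
  has_top m P a -> has_top k Q b -> has_top (m + k) (P * Q) (a * b).
Proof.
case=> sP <- [sQ <-]; split; last exact: coefM_top.
apply: leq_trans (size_polyMleq _ _) _.
by rewrite -subn1 leq_subLR add1n -addSn -addnS leq_add.
Qed.

Lemma line_poly_top f d u v : f \is d.-homog ->
  has_top d (line_poly f u v) f.@[v 0].
Proof.
elim/homog_ind => [|f' g [sf cf] [sg cg]|c m md].
- by rewrite /line_poly rmorph0 meval0 /has_top size_poly0 coef0.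
- rewrite line_polyD mevalD; split; last by rewrite coefD cf cg.
  by rewrite (leq_trans (size_polyD _ _)) // geq_max sf sg.
rewrite /line_poly mmapZ mmapX mevalZ mevalX.
suff H : has_top d (mmap1 (fun i => (u 0 i)%:P + v 0 i *: 'X) m)
           (\prod_i v 0 i ^+ m i).
  rewrite -[d]add0n; apply: has_topM H; split; last by rewrite coefC.
  by rewrite size_polyC leq_b1.
rewrite /mmap1 -md mdegE.
apply: (big_ind3 (fun k P c => has_top k P c)) => [||i _].
- by rewrite /has_top size_poly1 coef1.
- by move=> *; apply: has_topM.
elim: (m i) => [|k IH]; first by rewrite /has_top !expr0 size_poly1 coef1.
rewrite !exprS -add1n; apply: has_topM IH; split; last first.
  by rewrite coefD coefC coefZ coefX mulr1 add0r.
rewrite (leq_trans (size_polyD _ _)) // geq_max size_polyC.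
by rewrite (leq_trans (leq_b1 _)) // (leq_trans (size_scale_leq _ _)) // size_polyX.
Qed.

Lemma size_line_poly f d u v : f \is d.-homog -> (size (line_poly f u v) <= d.+1)%N.
Proof. by move=> /(line_poly_top u v) []. Qed.

Lemma coef_line_top f d u v : f \is d.-homog -> (line_poly f u v)`_d = f.@[v 0].
Proof. by move=> /(line_poly_top u v) []. Qed.

Lemma coef_line0 f u v : (line_poly f u v)`_0 = f.@[u 0].
Proof. by rewrite -horner_coef0 horner_line scale0r addr0. Qed.

Lemma deriv_line f u v :
  (line_poly f u v)^`() = \sum_i v 0 i *: line_poly f^`M(i) u v.
Proof.
elim/mpoly_alg_ind: f => [c|j|f g IHf IHg|f g IHf IHg].
- rewrite /line_poly mmapC derivC big1 // => i _.
  by rewrite mderivC mmap0 scaler0.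
- rewrite {1}/line_poly mmapX mmap1U derivD derivC add0r derivZ derivX.
  rewrite (bigD1 j) //= big1 ?addr0 => [|i ne].
    have -> : ('X_j : {mpoly R[n]})^`M(j) = 1.
      rewrite mderivX mnm1E eqxx scale1r -mpolyX0; congr 'X_[_].
      by apply/mnmP => i; rewrite mnmBE mnm0E subnn.
    by rewrite /line_poly rmorph1.
  by rewrite mderivX mnm1E eq_sym (negPf ne) scale0r /line_poly mmap0 scaler0.
- rewrite line_polyD derivD IHf IHg -big_split; apply: eq_bigr => i _ /=.
  by rewrite mderivD line_polyD scalerDr.
rewrite {1}/line_poly rmorphM /= derivM -!/(line_poly _ _ _) IHf IHg.
rewrite mulr_suml mulr_sumr -big_split; apply: eq_bigr => i _ /=.
rewrite mderivM line_polyD /line_poly !rmorphM /= -!/(line_poly _ _ _).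
by rewrite scalerDr scalerAl scalerAr.
Qed.

Lemma coef_line1 f u v : (line_poly f u v)`_1 = dirder f v u.
Proof.
have -> : (line_poly f u v)`_1 = (line_poly f u v)^`()`_0.
  by rewrite coef_deriv mulr1n.
rewrite deriv_line coef_sum; apply: eq_bigr => i _.
by rewrite coefZ coef_line0.
Qed.

Lemma euler f d : f \is d.-homog -> \sum_i 'X_i * f^`M(i) = f *+ d.
Proof.
elim/homog_ind => [|f' g Hf Hg|c m md].
- by rewrite mul0rn big1 // => i _; rewrite mderiv0 mulr0.
- rewrite mulrnDl -Hf -Hg -big_split; apply: eq_bigr => i _ /=.
  by rewrite mderivD mulrDr.
rewrite -md mdegE -sumrMnr; apply: eq_bigr => i _.
rewrite mderivZ mderivX -scalerAr -scalerAr -mpolyXD.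
case E : (m i) => [|k]; first by rewrite scale0r mulr0n scaler0.
rewrite addmC submK ?lep1mP ?E //.
by rewrite scaler_nat -scalerMnr.
Qed.

Lemma dirder_self f d u : f \is d.-homog -> dirder f u u = f.@[u 0] *+ d.
Proof.
move=> /euler E; have := congr1 (meval (u 0)) E.
rewrite mevalMn raddf_sum => <-; apply: eq_bigr => i _ /=.
by rewrite mevalM mevalXU.
Qed.

(** Euler's identity along the line lets the derivative be read off at
  infinity without dividing by the degree. *)
Lemma coef_line_subtop f d u v : f \is d.+1.-homog ->
  (line_poly f u v)`_d = dirder f u v.
Proof.
move=> fh; set P := line_poly f u v.
have E : P *+ d.+1 = \sum_i u 0 i *: line_poly f^`M(i) u v + P^`() * 'X.
  have := congr1 (fun g => line_poly g u v) (euler fh).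
  rewrite /line_poly rmorphMn rmorph_sum /= -/(line_poly _ _ _) -/P => <-.
  rewrite deriv_line mulr_suml -big_split; apply: eq_bigr => i _ /=.
  rewrite rmorphM /= mmapX mmap1U -/(line_poly _ _ _) mulrDl mul_polyC.
  by rewrite -!scalerAl [_ * 'X]mulrC.
clearbody P; have := congr1 (fun Q : {poly R} => Q`_d) E.
rewrite /= coefMn coefD coefMX coef_sum.
have -> : \sum_i (u 0 i *: line_poly f^`M(i) u v)`_d = dirder f u v.
  by apply: eq_bigr => i _; rewrite coefZ (coef_line_top _ _ (dhomog_mderiv i fh)).
case: d fh {E} => [|d] fh /=; first by rewrite addr0.
by rewrite coef_deriv [LHS]mulrS => /addIr.
Qed.

Lemma dirderD f u v w : dirder f (u + v) w = dirder f u w + dirder f v w.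
Proof. by rewrite -big_split; apply: eq_bigr => i _ /=; rewrite mxE mulrDl. Qed.

Lemma dirderZ f c u w : dirder f (c *: u) w = c * dirder f u w.
Proof. by rewrite mulr_sumr; apply: eq_bigr => i _ /=; rewrite mxE mulrA. Qed.

Lemma dirder_sum f (I : finType) (c : I -> R) (u : I -> 'rV[R]_n) w :
  dirder f (\sum_i c i *: u i) w = \sum_i c i * dirder f (u i) w.
Proof.
apply: (big_ind2 (fun x y => dirder f x w = y)) => [|x y x' y' <- <-|i _].
- by rewrite /dirder big1 // => i _; rewrite mxE mul0r.
- exact: dirderD.
exact: dirderZ.
Qed.

End Line.

(** * Forms vanishing at all rational points *)

(** Coordinates are freed one at a time.  In a free coordinate the form is a
  polynomial of degree at most d whose coefficient of degree d is the value of g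
  at a basis vector, hence zero; d elements of F are then enough roots.  Without
  this remark the bound on d would be one lower, and d = q would be lost. *)
Lemma form_vanishes_ext (n : nat) (F : fieldType) (E : idomainType)
    (j : {rmorphism F -> E}) (d : nat) (s : seq F) (g : {mpoly F[n]}) :
  uniq s -> (d <= size s)%N -> g \is d.-homog ->
  (forall v : 'rV[F]_n, g.@[v 0] = 0) ->
  forall x : 'rV[E]_n, (map_mpoly j g).@[x 0] = 0.
Proof.
move=> us ds gh g0 x.
suff H k : forall x : 'rV[E]_n, (forall i : 'I_n, (k <= i)%N -> exists c, x 0 i = j c) ->
    (map_mpoly j g).@[x 0] = 0.
  by apply: (H n) => i; rewrite leqNgt ltn_ord.
elim: k => [|k IH] {}x xk.
  have [c cx] := (@fin_all_exists _ _ _ (fun i => xk i (leq0n i))).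
  have -> : x = map_mx j (\row_i c i) by apply/rowP => i; rewrite cx !mxE.
  by rewrite meval_rmorph g0 rmorph0.
have [kn|nk] := ltnP k n; last first.
  by apply: IH => i /(leq_trans nk); rewrite leqNgt ltn_ord.
pose k' := Ordinal kn.
pose x0 : 'rV[E]_n := \row_i (if i == k' then 0 else x 0 i).
pose P := line_poly (map_mpoly j g) x0 (delta_mx 0 k').
have xE c : (x0 + c *: delta_mx 0 k') 0 =1 (fun i => if i == k' then c else x 0 i).
  move=> i; rewrite !mxE eqxx /=; case: eqP => _; first by rewrite add0r mulr1.
  by rewrite mulr0 addr0.
suff P0 : P = 0.
  have := horner_line (map_mpoly j g) x0 (delta_mx 0 k') (x 0 k').
  rewrite -/P P0 horner0 (meval_eq _ (xE _)) => ->; apply: meval_eq => i.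
  by case: eqP => // ->.
have sP : (size P <= d)%N.
  have [] := line_poly_top x0 (delta_mx 0 k') (dhomog_map j gh).
  rewrite -/P leq_eqVlt => /predU1P [eq|//] top; move: (top).
  rewrite -[d in P`_d]/(d.+1.-1) -eq -lead_coefE.
  have -> : delta_mx 0 k' = map_mx j (delta_mx 0 k') :> 'rV_n.
    by apply/rowP => i; rewrite !mxE rmorph_nat.
  rewrite meval_rmorph g0 rmorph0 => /eqP; rewrite lead_coef_eq0 => /eqP P0.
  by rewrite P0 size_poly0.
apply: (@roots_geq_poly_eq0 _ P (map j s)); last by rewrite size_map (leq_trans sP).
  apply/allP => _ /mapP [c _ ->]; apply/rootP; rewrite horner_line.
  apply: IH => i ki; rewrite xE; case: eqP => [_|/eqP ne]; first by exists c.
  by apply: xk; rewrite ltn_neqAle ki andbT eq_sym.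
by rewrite map_inj_uniq //; apply: fmorph_inj.
Qed.

(** The generic point of affine n-space is a point over the polynomial ring. *)
Lemma form_vanishes0 (n : nat) (F : fieldType) (d : nat) (s : seq F) (g : {mpoly F[n]}) :
  uniq s -> (d <= size s)%N -> g \is d.-homog ->
  (forall v : 'rV[F]_n, g.@[v 0] = 0) -> g = 0.
Proof.
move=> us ds gh g0.
have := form_vanishes_ext (@mpolyC n F) us ds gh g0 (\row_i 'X_i).
rewrite meval_map (_ : mmap _ _ _ = g) // [RHS]mpolyE; apply: eq_bigr => m _.
rewrite mul_mpolyC; congr (_ *: _); rewrite mpolyXE_id.
by apply: eq_bigr => i _; rewrite mxE.
Qed.

Lemma fin_form_vanishes_ext (n : nat) (F : finFieldType) (E : idomainType)
    (j : {rmorphism F -> E}) (d : nat) (g : {mpoly F[n]}) :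
  (d <= #|F|)%N -> g \is d.-homog -> (forall v : 'rV[F]_n, g.@[v 0] = 0) ->
  forall x : 'rV[E]_n, (map_mpoly j g).@[x 0] = 0.
Proof. by rewrite cardE; apply: form_vanishes_ext; apply: enum_uniq. Qed.

Lemma fin_form_vanishes0 (n : nat) (F : finFieldType) (d : nat) (g : {mpoly F[n]}) :
  (d <= #|F|)%N -> g \is d.-homog -> (forall v : 'rV[F]_n, g.@[v 0] = 0) -> g = 0.
Proof. by rewrite cardE; apply: form_vanishes0; apply: enum_uniq. Qed.

Lemma closed_uniq_seq (K : closedFieldType) m : exists2 s : seq K, uniq s & size s = m.
Proof.
elim: m => [|m [s us <-]]; first by exists [::].
have : \prod_(c <- s) ('X - c%:P) != 0.
  by rewrite monic_neq0 // monic_prod_XsubC.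
by case/closed_nonrootP => x; rewrite root_prod_XsubC => xs; exists (x :: s); rewrite //= xs.
Qed.

(** * Two plane curves meet *)

Lemma rank_basis (F : fieldType) m n k (A : 'M[F]_(m, n)) :
  \rank A = k -> exists2 B : 'M[F]_(k, n), row_free B & (B :=: A)%MS.
Proof. by move=> <-; exists (row_base A); [apply: row_base_free | apply: eq_row_base]. Qed.

Lemma map_mpoly_mmap (n : nat) (R S T : comNzRingType) (h : {rmorphism R -> S})
    (k : {rmorphism S -> T}) (x : 'I_n -> T) f :
  mmap k x (map_mpoly h f) = mmap (k \o h) x f.
Proof.
elim/mpoly_alg_ind: f => [c|i|f g IHf IHg|f g IHf IHg].
- by rewrite map_mpolyC !mmapC.
- by rewrite map_mpolyX !mmapX.
- by rewrite !rmorphD /= IHf IHg.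
- by rewrite !rmorphM /= IHf IHg.
Qed.

Lemma map_line_poly (n : nat) (R S : comNzRingType) (h : {rmorphism R -> S})
    (f : {mpoly R[n]}) (u v : 'rV[R]_n) :
  map_poly h (line_poly f u v) =
  line_poly (map_mpoly h f) (map_mx h u) (map_mx h v).
Proof.
rewrite /line_poly map_mpoly_mmap.
rewrite (@mmap_rmorph _ _ _ _ _ _ _ (fun i => (map_mx h u 0 i)%:P + map_mx h v 0 i *: 'X)).
  by rewrite /mmap; apply: eq_bigr => m _ /=; rewrite map_polyC.
by move=> i; rewrite rmorphD /= map_polyC map_polyZ /= map_polyX !mxE.
Qed.

Lemma map_mpoly_cancel (n : nat) (R S : comNzRingType) (h : {rmorphism R -> S})
    (k : {rmorphism S -> R}) (f : {mpoly R[n]}) :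
  cancel h k -> map_mpoly k (map_mpoly h f) = f.
Proof. by move=> hk; apply/mpolyP => m; rewrite !mcoeff_map_mpoly; apply: hk. Qed.

Lemma coef_comp_scaleX (R : comNzRingType) (p : {poly R}) c k :
  (p \Po (c *: 'X))`_k = c ^+ k * p`_k.
Proof.
rewrite comp_polyE coef_sum; under eq_bigr => i _ do rewrite exprZn scalerA coefZ coefXn.
have [lt|ge] := ltnP k (size p); last first.
  rewrite nth_default // mulr0 big1 // => i _.
  by rewrite gtn_eqF ?mulr0 // (leq_trans _ ge).
rewrite (bigD1 (Ordinal lt)) //= eqxx mulr1 mulrC big1 ?addr0 // => i ne.
by move: ne; rewrite -val_eqE /= eq_sym => /negPf ->; rewrite mulr0.
Qed.

Lemma closed_poly_eq0 (K : closedFieldType) (p : {poly K}) :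
  (forall x, p.[x] = 0) -> p = 0.
Proof.
move=> p0; have [s us ss] := closed_uniq_seq K (size p).
apply: (@roots_geq_poly_eq0 _ p s) => //; last by rewrite ss.
by apply/allP => x _; apply/rootP.
Qed.

Section Sylvester.

(** The Sylvester matrix with its size fixed in advance, so that its determinant
  specializes well even where the degrees of P and Q drop. *)
Definition sylv (R : comNzRingType) r (P Q : {poly R}) : 'M[R]_(r + r) :=
  \matrix_(i, j) (if (i < r)%N then (P * 'X^i)`_j else (Q * 'X^(i - r))`_j).

Lemma map_sylv (R S : comNzRingType) (h : {rmorphism R -> S}) r P Q :
  map_mx h (sylv r P Q) = sylv r (map_poly h P) (map_poly h Q).
Proof.
apply/matrixP => i j; rewrite !mxE; case: ifP => _.
  by rewrite -(map_polyXn h) -rmorphM /= coef_map.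
by rewrite -(map_polyXn h) -rmorphM /= coef_map.
Qed.

Lemma sylv_common_root (K : closedFieldType) r (P Q : {poly K}) :
  size P = r.+1 -> (size Q <= r.+1)%N -> \det (sylv r P Q) = 0 ->
  exists z, P.[z] = 0 /\ Q.[z] = 0.
Proof.
move=> sP sQ /eqP/det0P [v v0 vS].
pose U := \poly_(i < r) (if insub i is Some k then v 0 (lshift r k) else 0).
pose V := \poly_(i < r) (if insub i is Some k then v 0 (rshift r k) else 0).
have UE : U = \sum_(i < r) v 0 (lshift r i) *: 'X^i.
  by rewrite /U poly_def; apply: eq_bigr => i _; rewrite valK.
have VE : V = \sum_(i < r) v 0 (rshift r i) *: 'X^i.
  by rewrite /V poly_def; apply: eq_bigr => i _; rewrite valK.
have UV : U * P + V * Q = 0.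
  apply/polyP => j; rewrite coef0; have [lt|ge] := ltnP j (r + r); last first.
    have sM (p p' : {poly K}) : (size p <= r)%N -> (size p' <= r.+1)%N ->
        (size (p * p')%R <= r + r)%N.
      move=> sp sp'; apply: leq_trans (size_polyMleq _ _) _.
      by rewrite -subn1 leq_subLR add1n -addnS leq_add.
    rewrite nth_default // (leq_trans (size_polyD _ _)) // (leq_trans _ ge) //.
    by rewrite geq_max !sM ?size_poly ?sP.
  have H : \sum_k v 0 k * sylv r P Q k (Ordinal lt) = 0.
    by have := congr1 (fun M : 'rV_(r + r) => M 0 (Ordinal lt)) vS; rewrite !mxE.
  rewrite -[RHS]H big_split_ord /= UE VE coefD !mulr_suml !coef_sum.
  congr (_ + _); apply: eq_bigr => i _; rewrite mxE /= -scalerAl coefZ.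
    by rewrite ltn_ord [P * _]mulrC.
  by rewrite ltnNge leq_addr /= addKn [Q * _]mulrC.
have [cop|] := boolP (coprimep P Q).
  have PV : P %| V.
    rewrite -(Gauss_dvdpl _ cop) -(dvdp_addr _ (dvdp_mull U (dvdpp P))) UV.
    exact: dvdp0.
  have V0 : V = 0.
    apply/eqP; apply: contraTT isT => V0.
    by have := dvdp_leq V0 PV; rewrite sP ltnNge size_poly.
  have U0 : U = 0.
    move/eqP: UV; rewrite V0 mul0r addr0 mulf_eq0 => /orP [/eqP //|/eqP P0].
    by rewrite P0 size_poly0 in sP.
  case/eqP: v0; apply/rowP => i; rewrite mxE -(splitK i).
  case: (split i) => k /=.
    have := congr1 (fun p : {poly K} => p`_k) U0.
    by rewrite coef_poly ltn_ord valK coef0.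
  have := congr1 (fun p : {poly K} => p`_k) V0.
  by rewrite coef_poly ltn_ord valK coef0.
rewrite /coprimep => /closed_rootP [z]; rewrite root_gcd => /andP [/rootP Pz /rootP Qz].
by exists z.
Qed.

(** Row and column scalings compare the two matrices: entry (i, j) of the first
  times t^j is entry (i, j) of the second times t^(i + r) or t^i. *)
Lemma det_sylv_scale (K : fieldType) r (P Q P' Q' : {poly K}) t : t != 0 ->
  (forall k, t ^+ k * P'`_k = t ^+ r * P`_k) ->
  (forall k, t ^+ k * Q'`_k = t ^+ r * Q`_k) ->
  \det (sylv r P' Q') = t ^+ (r * r) * \det (sylv r P Q).
Proof.
move=> t0 hP hQ.
pose D := diag_mx (\row_(j < r + r) t ^+ j).
pose D' := diag_mx (\row_(j < r + r) t ^+ (j + (if j < r then r else 0))%N).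
have E : sylv r P' Q' *m D = D' *m sylv r P Q.
  apply/matrixP => i j; rewrite mul_mx_diag mul_diag_mx !mxE.
  case: ifP => ir; rewrite !coefMXn; case: ltnP => ji; rewrite ?mul0r ?mulr0 //.
    by rewrite mulrC -{1}(subnKC ji) !exprD -!mulrA hP.
  rewrite addn0 mulrC -{1}(subnKC ji) exprD -!mulrA hQ mulrA -exprD subnK //.
  by rewrite leqNgt ir.
have nz : \prod_(j < r + r) t ^+ j != 0.
  by apply/prodf_neq0 => j _; rewrite expf_neq0.
move/(congr1 determinant): E; rewrite !det_mulmx !det_diag.
under eq_bigr => j _ do rewrite mxE.
under [in RHS]eq_bigr => j _ do rewrite mxE exprD.
rewrite big_split /= mulrC -mulrA => /(mulfI nz) ->; congr (_ * _).
rewrite big_split_ord /= [X in _ * X]big1 ?mulr1 => [|i _]; last first.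
  by rewrite ltnNge leq_addr expr0.
under eq_bigr => i _ do rewrite ltn_ord.
by rewrite prodr_const card_ord exprM.
Qed.

End Sylvester.

Lemma line_poly_scale (K : closedFieldType) n d (f : {mpoly K[n]}) t u v k :
  f \is d.-homog ->
  t ^+ k * (line_poly f (t *: u) v)`_k = t ^+ d * (line_poly f u v)`_k.
Proof.
move=> fh; rewrite -coef_comp_scaleX -coefZ; congr ((polyseq _)`_k); apply/eqP;
  rewrite -subr_eq0; apply/eqP.
apply: closed_poly_eq0 => x; rewrite !hornerE horner_comp !hornerE !horner_line.
rewrite (_ : t *: u + (t * x) *: v = t *: (u + x *: v)).
  by rewrite (meval_scale _ _ fh) subrr.
by rewrite scalerDr scalerA.
Qed.

Lemma sylv_line_zero (K : closedFieldType) n r (A B : {mpoly K[n]}) (u c : 'rV[K]_n) :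
  A \is r.-homog -> B \is r.-homog -> A.@[c 0] != 0 ->
  \det (sylv r (line_poly A u c) (line_poly B u c)) = 0 ->
  exists z, A.@[(u + z *: c) 0] = 0 /\ B.@[(u + z *: c) 0] = 0.
Proof.
move=> Ah Bh Ac /sylv_common_root [||z [Az Bz]].
- have [sA cA] := line_poly_top u c Ah; apply/eqP; rewrite eqn_leq sA ltnNge /=.
  by apply: contra Ac => lt; rewrite -cA nth_default.
- exact: size_line_poly.
by exists z; rewrite -!horner_line.
Qed.

(** Projecting from a point c off V(A), the resultant N of A and B is a form of
  positive degree in the two remaining coordinates, so it has a zero, and a zero
  of N lifts to a common zero of A and B.  Homogeneity of N is used only in the
  form [Nscale].  The conclusion is stated negatively because the choice of c
  rests on deciding whether a form is zero at every point. *)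
Lemma plane_curves_meet (K : closedFieldType) r (A B : {mpoly K[3]}) :
  A \is r.+1.-homog -> B \is r.+1.-homog ->
  (forall x : 'rV[K]_3, A.@[x 0] = 0 -> B.@[x 0] = 0 -> x = 0) -> False.
Proof.
move=> Ah Bh nz.
have [s us ss] := closed_uniq_seq K r.+1.
wlog A0 : A B Ah Bh nz / A != 0.
  move=> H; have [A0|] := eqVneq A 0; last exact: (H A B).
  have [B0|] := eqVneq B 0; last by apply: (H B A) => // x Bx Ax; apply: nz.
  have := nz (const_mx 1); rewrite A0 B0 !meval0 => /(_ erefl erefl) /rowP /(_ 0).
  by rewrite !mxE => /eqP; rewrite oner_eq0.
case/eqP: A0; apply: (form_vanishes0 us _ Ah); rewrite ?ss // => c.
apply/eqP; apply: contraT => Ac; exfalso.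
have c0 : c != 0 by apply: contraNneq Ac => ->; rewrite (meval_at0 _ Ah).
have rW : \rank (c^C)%MS = 2%N by rewrite mxrank_compl rank_rV c0.
have [W Wf eW] := rank_basis rW.
have indep (a b z : K) : a *: row 0 W + b *: row 1 W + z *: c = 0 -> a = 0 /\ b = 0.
  move=> E; pose y : 'rV[K]_2 := \row_i (if i == 0 then a else b).
  have yW : y *m W = a *: row 0 W + b *: row 1 W.
    rewrite mulmx_sum_row big_ord_recl big_ord1.
    by rewrite (_ : lift ord0 ord0 = 1) ?[y _ _]mxE //; apply: val_inj.
  have : (y *m W <= (c :&: c^C)%MS)%MS.
    rewrite sub_capmx; apply/andP; split.
      by move: E; rewrite -yW => /eqP; rewrite addr_eq0 => /eqP ->;
        rewrite eqmx_opp scalemx_sub.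
    by rewrite -eW submxMl.
  rewrite capmx_compl submx0 mulmx_free_eq0 // => /eqP /rowP y0.
  by split; [have := y0 0 | have := y0 1]; rewrite !mxE.
pose N x := \det (sylv r.+1 (line_poly A x c) (line_poly B x c)).
have N0 x : N x = 0 -> exists z, x + z *: c = 0.
  by move=> /(sylv_line_zero Ah Bh Ac) [z [Az Bz]]; exists z; apply: nz.
have Nscale t x : t != 0 -> N (t *: x) = t ^+ (r.+1 * r.+1) * N x.
  by move=> t0; apply: det_sylv_scale => // k; apply: line_poly_scale.
pose C := @polyC K.
pose Np x : {poly K} := \det (sylv r.+1
  (line_poly (map_mpoly C A) x (map_mx C c)) (line_poly (map_mpoly C B) x (map_mx C c))).
have NpE t x : (Np x).[t] = N (map_mx (horner_eval t) x).
  have Ck : cancel C (horner_eval t) by move=> a; rewrite horner_evalE hornerC.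
  rewrite -horner_evalE -det_map_mx map_sylv !map_line_poly !map_mpoly_cancel //.
  rewrite (_ : map_mx _ (map_mx C c) = c) //.
  by apply/rowP => i; rewrite !mxE; apply: Ck.
set u := row 0 W; set v := row 1 W in indep.
(* The two affine charts of the form N. *)
pose P1 := Np ('X *: map_mx C u + map_mx C v).
pose P2 := Np (map_mx C u + 'X *: map_mx C v).
have P1E t : P1.[t] = N (t *: u + v).
  by rewrite NpE; congr N; apply/rowP => i; rewrite !mxE horner_evalE !hornerE.
have P2E t : P2.[t] = N (u + t *: v).
  by rewrite NpE; congr N; apply/rowP => i; rewrite !mxE horner_evalE !hornerE.
have /eqP/size_poly1P [k k0 P1k] : size P1 = 1%N.
  apply/eqP; apply: contraT => /closed_rootP [t /rootP]; rewrite P1E => /N0 [z].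
  by rewrite -[v]scale1r => /indep [_ /eqP]; rewrite oner_eq0.
have P2k : 'X * (P2 - k *: 'X^(r.+1 * r.+1)) = 0.
  apply: closed_poly_eq0 => t; rewrite !hornerE P2E.
  have [->|t0] := eqVneq t 0; first by rewrite mul0r.
  have -> : u + t *: v = t *: (t^-1 *: u + v) by rewrite scalerDr scalerA mulfV // scale1r.
  by rewrite Nscale // -P1E P1k hornerC mulrC [k * _]mulrC subrr mul0r.
move/eqP: P2k; rewrite mulf_eq0 polyX_eq0 subr_eq0 /= => /eqP P2k.
have : P2.[0] = 0 by rewrite P2k !hornerE expr0n /= mulr0.
rewrite P2E => /N0 [z]; rewrite -[u]scale1r => /indep [/eqP]; by rewrite oner_eq0.
Qed.

(** * Planes, lines and tangent spaces of a nonsingular hypersurface *)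

Lemma dhomog_comp (n k d : nat) (R : comNzRingType) (l : n.-tuple {mpoly R[k]})
    (f : {mpoly R[n]}) :
  (forall i, tnth l i \is 1.-homog) -> f \is d.-homog -> f \mPo l \is d.-homog.
Proof.
move=> l1; elim/homog_ind => [|f' g Hf Hg|c m md].
- by rewrite comp_mpoly0 dhomog0.
- by rewrite comp_mpolyD dhomogD.
rewrite comp_mpolyZ comp_mpolyX dhomogZ // -md mdegE.
apply: (big_ind2 (fun (e : nat) (P : {mpoly R[k]}) => P \is e.-homog)) => [||i _].
- exact: dhomog1.
- by move=> a P b Q; apply: dhomogM.
by have := dhomogMn (m i) (l1 i); rewrite mul1n.
Qed.

Lemma dhomogX1 (n : nat) (R : comNzRingType) (i : 'I_n) : ('X_i : {mpoly R[n]}) \is 1.-homog.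
Proof. by rewrite dhomogX /= mdeg1. Qed.

Lemma dhomog_bigsum (n d : nat) (R : comNzRingType) (I : finType) (g : I -> {mpoly R[n]}) :
  (forall i, g i \is d.-homog) -> \sum_i g i \is d.-homog.
Proof.
by move=> gh; apply: (big_ind (fun P : {mpoly R[n]} => P \is d.-homog)) => //;
  [apply: dhomog0 | move=> x y; apply: dhomogD].
Qed.

Section Restrict.

Variables (F : fieldType) (n : nat).

Lemma dhomog_restrict m (M : 'M[F]_(m, n)) d (p : {mpoly F[n]}) :
  p \is d.-homog -> restrict M p \is d.-homog.
Proof.
apply: dhomog_comp => j; rewrite tnth_mktuple; apply: dhomog_bigsum => i.
by rewrite dhomogZ // dhomogX1.
Qed.

Lemma dhomog_cone d (g : {mpoly F[n]}) : g \is d.-homog -> cone g \is d.-homog.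
Proof. by apply: dhomog_comp => j; rewrite tnth_mktuple dhomogX1. Qed.

Lemma meval_restrict m (M : 'M[F]_(m, n)) (p : {mpoly F[n]}) (y : 'rV[F]_m) :
  (restrict M p).@[y 0] = p.@[(y *m M) 0].
Proof.
rewrite comp_mpoly_meval; apply: meval_eq => j; rewrite tnth_mktuple mxE.
by rewrite raddf_sum; apply: eq_bigr => i _ /=; rewrite mevalZ mevalXU mulrC.
Qed.

Lemma meval_cone (g : {mpoly F[n]}) (y : 'rV[F]_(1 + n)) :
  (cone g).@[y 0] = g.@[(rsubmx y) 0].
Proof.
rewrite comp_mpoly_meval; apply: meval_eq => j.
by rewrite tnth_mktuple mevalXU mxE.
Qed.

Lemma restrict_map (K : fieldType) (h : {rmorphism F -> K}) m (M : 'M[F]_(m, n)) p :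
  map_mpoly h (restrict M p) = restrict (map_mx h M) (map_mpoly h p).
Proof.
rewrite /restrict map_mpoly_comp; last exact: fmorph_inj.
congr comp_mpoly; apply: eq_from_tnth => j; rewrite tnth_map !tnth_mktuple.
by rewrite raddf_sum; apply: eq_bigr => i _ /=; rewrite map_mpolyZ map_mpolyX mxE.
Qed.

Lemma dirder_mulmx m (y : 'rV[F]_m) (M : 'M[F]_(m, n)) p w :
  dirder p (y *m M) w = \sum_i y 0 i * dirder p (row i M) w.
Proof. by rewrite mulmx_sum_row dirder_sum. Qed.

Definition dirder_form (w : 'rV[F]_n) (p : {mpoly F[n]}) : {mpoly F[n]} :=
  \sum_i w 0 i *: p^`M(i).

Lemma meval_dirder_form (w u : 'rV[F]_n) p : (dirder_form w p).@[u 0] = dirder p w u.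
Proof. by rewrite raddf_sum; apply: eq_bigr => i _ /=; rewrite mevalZ. Qed.

Lemma dhomog_dirder_form w p d : p \is d.+1.-homog -> dirder_form w p \is d.-homog.
Proof. by move=> ph; apply: dhomog_bigsum => i; rewrite dhomogZ // dhomog_mderiv. Qed.

End Restrict.

Lemma binary_form_zero (K : closedFieldType) r (g : {mpoly K[2]}) :
  g \is r.+1.-homog -> exists2 x : 'rV[K]_2, x != 0 & g.@[x 0] = 0.
Proof.
move=> gh; pose P := line_poly g (delta_mx 0 0) (delta_mx 0 1).
have [/eqP P1|/closed_rootP [t /rootP Pt]] := boolP (size P == 1%N).
  exists (delta_mx 0 1); last by rewrite -(coef_line_top (delta_mx 0 0) _ gh) nth_default // -/P P1.
  by apply/eqP => /rowP /(_ 1) /eqP; rewrite !mxE /= oner_eq0.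
exists (delta_mx 0 0 + t *: delta_mx 0 1); last by rewrite -horner_line.
by apply/eqP => /rowP /(_ 0) /eqP; rewrite !mxE /= mulr0 addr0 oner_eq0.
Qed.

Section Nonsingular.

Variables (F : finFieldType) (K : closedFieldType) (iota : {rmorphism F -> K}).
Variables (n r : nat) (p : {mpoly F[n]}).
Hypotheses (hp : p \is r.+2.-homog) (hq : (r.+2 <= #|F|)%N).
Hypothesis hns : nonsingular iota p.

Lemma nonsingular_dirder (v : 'rV[F]_n) : v != 0 -> p.@[v 0] = 0 ->
  exists i, (p^`M(i)).@[v 0] != 0.
Proof.
move=> v0 pv; apply/existsP; apply: contraT; rewrite negb_exists => /forallP H.
exfalso; apply: hns; exists (map_mx iota v); split.
  rewrite /lies_on meval_rmorph pv rmorph0 eqxx andbT.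
  by rewrite map_mx_eq0.
move=> i; have := H i; rewrite negbK => /eqP Hi.
by rewrite meval_rmorph Hi rmorph0.
Qed.

Lemma rank_tangent (v : 'rV[F]_n) : v != 0 -> p.@[v 0] = 0 ->
  \rank (tangent_space p v) = n.-1.
Proof.
move=> v0 pv; rewrite /tangent_space mxrank_ker.
set C := \col_i _; rewrite (_ : \rank C = 1%N) ?subn1 //.
have C0 : C != 0.
  have [i] := nonsingular_dirder v0 pv; apply: contraNneq => /colP /(_ i).
  by rewrite !mxE => ->.
by apply/eqP; rewrite eqn_leq rank_leq_col lt0n mxrank_eq0.
Qed.

Lemma sub_tangent (v w : 'rV[F]_n) : (w <= tangent_space p v)%MS = (dirder p w v == 0).
Proof.
rewrite /tangent_space sub_kermx; apply/eqP/eqP => [/rowP /(_ 0)|H].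
  by rewrite !mxE => E; rewrite -[RHS]E; apply: eq_bigr => i _; rewrite mxE.
apply/rowP => j; rewrite !mxE -[RHS]H; apply: eq_bigr => i _; by rewrite mxE.
Qed.

(** Vanishing on the rational points of a subspace propagates to the closure. *)
Lemma vanishes_on_ext m (M : 'M[F]_(m, n)) d (f : {mpoly F[n]}) :
  (d <= #|F|)%N -> f \is d.-homog -> (forall y : 'rV_m, f.@[(y *m M) 0] = 0) ->
  forall x : 'rV[K]_m, (map_mpoly iota f).@[(x *m map_mx iota M) 0] = 0.
Proof.
move=> dq fh f0 x; rewrite -meval_restrict -restrict_map.
apply: (fin_form_vanishes_ext iota dq (dhomog_restrict M fh)) => v.
by rewrite meval_restrict.
Qed.

(** If all partial derivatives were multiples of one of them along L, a zero of
  that one would be a singular point. *)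
Lemma nonsingular_line_rank (L : 'M[F]_(2, n)) (i0 : 'I_n) : row_free L ->
  (forall y : 'rV_2, p.@[(y *m L) 0] = 0) ->
  (forall i, exists z, forall y : 'rV_2,
     (p^`M(i)).@[(y *m L) 0] = z * (p^`M(i0)).@[(y *m L) 0]) -> False.
Proof.
move=> Lf p0 H.
have pK := vanishes_on_ext hq hp p0.
have dK i := dhomog_restrict (map_mx iota L) (dhomog_map iota (dhomog_mderiv i hp)).
have [x x0] := binary_form_zero (dK i0); rewrite meval_restrict => Gx.
apply: hns; exists (x *m map_mx iota L); split.
  by rewrite /lies_on pK eqxx andbT mulmx_free_eq0 // row_free_map.
move=> i; have [z Hz] := H i.
have fh : p^`M(i) - z *: p^`M(i0) \is r.+1.-homog.
  by rewrite dhomogD ?dhomogN ?dhomogZ ?dhomog_mderiv.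
have f0 (y : 'rV_2) : (p^`M(i) - z *: p^`M(i0)).@[(y *m L) 0] = 0.
  by rewrite mevalB mevalZ Hz subrr.
have := vanishes_on_ext (ltnW hq) fh f0 x.
rewrite rmorphB /= map_mpolyZ mevalB mevalZ Gx mulr0 subr0; exact.
Qed.

End Nonsingular.

Section NonsingularThreefold.

Variables (F : finFieldType) (K : closedFieldType) (iota : {rmorphism F -> K}).
Variables (r : nat) (p : {mpoly F[5]}).
Hypotheses (hp : p \is r.+2.-homog) (hq : (r.+2 <= #|F|)%N).
Hypothesis hns : nonsingular iota p.

(** At a common zero, on the plane, of the two derivatives transverse to it, all
  partial derivatives vanish, since those along the plane vanish anyway. *)
Lemma nonsingular_no_plane (M : 'M[F]_(3, 5)) : row_free M ->
  (forall y : 'rV_3, p.@[(y *m M) 0] = 0) -> False.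
Proof.
move=> Mf p0.
have pK := vanishes_on_ext iota hq hp p0.
have rC : \rank (M^C)%MS = 2%N.
  by rewrite mxrank_compl (eqP Mf).
have [C Cf eC] := rank_basis rC.
have full : row_full (col_mx M C).
  by rewrite -sub1mx -addsmxE (adds_eqmx (eqmx_refl M) eC) sub1mx addsmx_compl_full.
set pKm := map_mpoly iota p.
pose A k : {mpoly K[3]} := restrict (map_mx iota M) (dirder_form (row k (map_mx iota C)) pKm).
have Ah k : A k \is r.+1.-homog.
  by apply/dhomog_restrict/dhomog_dirder_form/dhomog_map.
apply: (plane_curves_meet (Ah 0) (Ah 1)) => x;
  rewrite !meval_restrict !meval_dirder_form => A0 A1.
apply/eqP; apply: contraT => x0; exfalso; apply: hns.
set v := x *m map_mx iota M in A0 A1.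
have Mf' : row_free (map_mx iota M) by rewrite row_free_map.
exists v; split.
  by rewrite /lies_on -/pKm pK eqxx andbT mulmx_free_eq0.
have inplane k : dirder pKm (row k (map_mx iota M)) v = 0.
  rewrite -coef_line1 (_ : line_poly _ _ _ = 0) ?coef0 //.
  apply: closed_poly_eq0 => t; rewrite horner_line rowE scalemxAl -mulmxDl.
  exact: pK.
have d0 w : dirder pKm w v = 0.
  have : (w <= col_mx (map_mx iota M) (map_mx iota C))%MS.
    by rewrite -map_col_mx submx_full // row_full_map.
  case/submxP => y ->; rewrite -[y]hsubmxK mul_row_col dirderD !dirder_mulmx.
  rewrite !big1 ?addr0 // => k _; last by rewrite inplane mulr0.
  by have [->|->] : k = 0 \/ k = 1; rewrite ?A0 ?A1 ?mulr0 //;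
     case: k => -[|[|//]] ?; [left|right]; apply: val_inj.
move=> i; have := d0 (delta_mx 0 i); rewrite /dirder (bigD1 i) //= big1 ?addr0.
  by rewrite mxE !eqxx mul1r mderiv_map.
by move=> j ne; rewrite mxE (negPf ne) mul0r.
Qed.

End NonsingularThreefold.

(** * Zeros of bivariate polynomials over a finite field *)

Section Bivariate.

Variable R : comNzRingType.
Implicit Types (P Q : {poly {poly R}}) (s t : R).

Definition ev2 P s t : R := P.[s%:P].[t].

(** Total degree at most m, the two variables being treated alike although they
  sit at different levels. *)
Definition tdeg m P := forall i j, (m < i + j)%N -> P`_i`_j = 0.

Definition slice P t : {poly R} := map_poly (horner_eval t) P.

Lemma horner_slice P s t : (slice P t).[s] = ev2 P s t.
Proof.
rewrite /slice -[s in LHS](hornerC s t) -[X in (map_poly _ _).[X]]/(horner_eval t s%:P).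
by rewrite horner_map.
Qed.

Lemma coef_slice P t i : (slice P t)`_i = (P`_i).[t].
Proof. by rewrite coef_map. Qed.

Lemma tdeg_size m P : tdeg m P -> (size P <= m.+1)%N.
Proof.
move=> Pm; apply/leq_sizeP => i mi; apply/polyP => j; rewrite coef0.
by apply: Pm; rewrite ltn_addr.
Qed.

Lemma tdeg_coef_size m P i : tdeg m P -> (size (P`_i)%R <= m.+1 - i)%N.
Proof. by move=> Pm; apply/leq_sizeP => j; rewrite leq_subLR; apply: Pm. Qed.

Lemma tdegM m k P Q : tdeg m P -> tdeg k Q -> tdeg (m + k) (P * Q).
Proof.
move=> Pm Qk i j ij; rewrite coefM coef_sum big1 // => [[a /= ai]] _.
rewrite coefM big1 // => [[b /= bj]] _.
have [ab|ab] := ltnP m (a + b); first by rewrite Pm // mul0r.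
rewrite Qk ?mulr0 // -(ltn_add2l (a + b)).
apply: leq_ltn_trans (leq_add ab (leqnn _)) _.
by rewrite addnACA !subnKC.
Qed.

Lemma tdegD m P Q : tdeg m P -> tdeg m Q -> tdeg m (P + Q).
Proof. by move=> Pm Qm i j ij; rewrite !coefD Pm // Qm // addr0. Qed.

(** The homogeneous part of degree k, as a function. *)
Definition diag k P s t : R := \sum_(i < k.+1) s ^+ i * t ^+ (k - i) * P`_i`_(k - i).

(** Both variables are sent to multiples of one variable, which collects the terms
  of each total degree in one coefficient. *)
Lemma coef_diag k P s t :
  (map_poly (comp_poly (t *: 'X)) P).[s *: 'X]`_k = diag k P s t.
Proof.
rewrite (@horner_coef_wide _ (k.+1 + size P)); last first.
  by apply: leq_trans (size_poly _ _) _; apply: leq_addl.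
rewrite coef_sum big_split_ord /= [X in _ + X]big1 ?addr0 => [|i _]; last first.
  rewrite exprZn -scalerAr coefZ coefMXn.
  by rewrite ltn_addr ?mulr0 // ltnS leqnn.
apply: eq_bigr => i _; rewrite exprZn -scalerAr coefZ coefMXn ltnNge -ltnS ltn_ord /=.
by rewrite coef_map /= coef_comp_scaleX mulrA.
Qed.

Section PlanePoly.

Variable n : nat.
Implicit Types (f g : {mpoly R[n]}) (w a b : 'rV[R]_n).

(** (s, t) |-> f (w + s a + t b), with s as the outer variable. *)
Definition plane_poly f w a b : {poly {poly R}} :=
  mmap ((@polyC _) \o (@polyC R))
    (fun i => ((w 0 i)%:P + b 0 i *: 'X)%:P + (a 0 i)%:P *: 'X) f.

Lemma ev2_plane f w a b s t : ev2 (plane_poly f w a b) s t = f.@[(w + (s *: a + t *: b)) 0].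
Proof.
rewrite -[LHS]/((horner_eval t \o horner_eval s%:P) _).
rewrite (@mmap_rmorph _ _ _ _ _ _ _ ((w + (s *: a + t *: b)) 0)).
  by rewrite /meval; apply: eq_bigr => m _ /=; rewrite !horner_evalE !hornerC.
move=> i; rewrite /= !horner_evalE !hornerE !mxE [b 0 i * _]mulrC [a 0 i * _]mulrC.
by rewrite addrAC.
Qed.

Lemma tdeg_plane f d w a b : f \is d.-homog -> tdeg d (plane_poly f w a b).
Proof.
elim/homog_ind => [|f' g Hf Hg|c m md].
- by rewrite /plane_poly mmap0 => i j _; rewrite !coef0.
- by rewrite /plane_poly mmapD; apply: tdegD.
rewrite /plane_poly mmapZ mmapX -[d]add0n; apply: tdegM => [i j|].
  rewrite coefC; case: i => [|i] /=; last by rewrite coef0.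
  by rewrite coefC; case: j.
rewrite -md mdegE.
apply: (big_ind2 (fun k P => tdeg k P)) => [|x y x' y' Hx Hx'|i _].
- by move=> [|i] [|j] //= _; rewrite coef1 /= ?coef1 ?coef0.
- exact: tdegM.
elim: (m i) => [|k IH].
  by rewrite expr0; move=> [|i'] [|j] //= _; rewrite coef1 /= ?coef1 ?coef0.
rewrite exprS -add1n; apply: tdegM IH => i' j ij.
rewrite coefD coefC coefZ coefX coefD.
case: i' ij => [|[|i']] ij /=.
- by rewrite mulr0 coef0 addr0 coefD coefC coefZ coefX; case: j ij => [|[|j]] //= _;
  rewrite mulr0 addr0.
- by rewrite coef0 add0r mulr1 coefC; case: j ij.
by rewrite mulr0 !coef0 addr0.
Qed.

Lemma diag_plane f w a b s t k :
  diag k (plane_poly f w a b) s t = (line_poly f w (s *: a + t *: b))`_k.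
Proof.
rewrite -coef_diag; congr ((polyseq _)`_k).
rewrite -[LHS]/((horner_eval (s *: 'X) \o map_poly (comp_poly (t *: 'X))) _).
rewrite (@mmap_rmorph _ _ _ _ _ _ _ (fun i => (w 0 i)%:P + (s *: a + t *: b) 0 i *: 'X)).
  by rewrite /line_poly; apply: eq_bigr => m _ /=;
    rewrite map_polyC /= comp_polyC horner_evalE hornerC.
move=> i; rewrite /= rmorphD /= map_polyC map_polyZ /= map_polyX horner_evalE !hornerE /=.
rewrite comp_polyD !comp_polyC comp_polyZ comp_polyX !mxE -addrA; congr (_ + _).
by rewrite mul_polyC !scalerA addrC scalerDl [s * _]mulrC [t * _]mulrC.
Qed.

End PlanePoly.

End Bivariate.

Section FiniteCount.

Variable F : finFieldType.
Local Notation q := #|F|.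

Lemma poly_fin_eq0 (P : {poly F}) : (size P <= q)%N -> (forall x, P.[x] = 0) -> P = 0.
Proof.
move=> sP P0; apply: (@roots_geq_poly_eq0 _ P (enum F)); rewrite ?enum_uniq -?cardE //.
by apply/allP => x _; apply/rootP.
Qed.

Lemma card_poly_roots (P : {poly F}) k : P != 0 -> (size P <= k.+1)%N ->
  (#|[set x | P.[x] == 0%R]| <= k)%N.
Proof.
move=> P0 sP; rewrite -ltnS (leq_trans _ sP) // cardE.
by apply: max_poly_roots => //; [apply/allP => x; rewrite mem_enum inE | apply: enum_uniq].
Qed.

(** The value at (1, 0) disposes of the top coefficient, which allows k = q. *)
Lemma binary_form_coef0 k (c : nat -> F) : (k <= q)%N ->
  (forall s t, \sum_(i < k.+1) s ^+ i * t ^+ (k - i) * c i = 0) ->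
  forall i, (i <= k)%N -> c i = 0.
Proof.
move=> kq H.
have ck : c k = 0.
  have := H 1 0; rewrite big_ord_recr /= subnn expr0 expr1n !mul1r big1 ?add0r // => i _.
  by rewrite expr0n subn_eq0 leqNgt ltn_ord /= mulr0 mul0r.
pose P := \poly_(i < k) c i.
have P0 : P = 0.
  apply: poly_fin_eq0 => [|x]; first by rewrite (leq_trans (size_poly _ _)).
  have := H x 1; rewrite big_ord_recr /= ck mulr0 addr0 => <-.
  rewrite horner_poly; apply: eq_bigr => i _.
  by rewrite expr1n mulr1 mulrC.
move=> i; rewrite leq_eqVlt => /predU1P [->//|ik].
by have := coef_poly k c i; rewrite ik => <-; rewrite -/P P0 coef0.
Qed.

Implicit Type P : {poly {poly F}}.

Lemma tdeg_lower m P : tdeg m.+1 P -> (m < q)%N ->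
  (forall s t, diag m.+1 P s t = 0) -> tdeg m P.
Proof.
move=> Pm mq D i j; rewrite leq_eqVlt => /predU1P [eq|]; last exact: Pm.
have := @binary_form_coef0 m.+1 (fun i => P`_i`_(m.+1 - i)) mq D i.
by rewrite eq leq_addr addKn => /(_ isT).
Qed.

Definition null_lines P : {set F} := [set t | slice P t == 0].

Lemma null_linesP m P t : tdeg m P -> (m < q)%N ->
  reflect (forall s, ev2 P s t = 0) (t \in null_lines P).
Proof.
move=> Pm mq; rewrite inE; apply: (iffP eqP) => [H s|H].
  by rewrite -horner_slice H horner0.
apply: poly_fin_eq0 => [|s]; last by rewrite horner_slice.
by apply: leq_trans (size_poly _ _) _; rewrite (leq_trans (tdeg_size Pm)).
Qed.

(** The i-th coefficient has degree at most m - i and vanishes at every null line;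
  so null lines lower the degree in s, without any division by their
  equations. *)
Lemma null_lines_coef0 m P i : tdeg m P -> (m < i + #|null_lines P|)%N -> P`_i = 0.
Proof.
move=> Pm mi; apply: (@roots_geq_poly_eq0 _ _ (enum (null_lines P))).
- apply/allP => t; rewrite mem_enum inE => /eqP H; apply/rootP.
  by rewrite -coef_slice H coef0.
- exact: enum_uniq.
rewrite -cardE; apply: leq_trans (tdeg_coef_size i Pm) _.
by rewrite leq_subLR.
Qed.

Lemma card_null_lines m P : tdeg m P -> P != 0 -> (#|null_lines P| <= m)%N.
Proof.
move=> Pm; apply: contraNT; rewrite -ltnNge => mJ; apply/eqP/polyP => i.
by rewrite coef0; apply: (null_lines_coef0 Pm); rewrite ltn_addl.
Qed.

Definition zero_count P := #|[set x : F * F | ev2 P x.1 x.2 == 0]|.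

Lemma zero_count_slices P : zero_count P = (\sum_t #|[set s | ev2 P s t == 0%R]|)%N.
Proof.
rewrite /zero_count -sum1_card (eq_bigl (fun x : F * F => ev2 P x.1 x.2 == 0)); last first.
  by move=> x; rewrite inE.
rewrite big_mkcond /= -(pair_bigA_idem _ (fun s t => if ev2 P s t == 0 then 1%N else 0%N)) //=.
rewrite exchange_big; apply: eq_bigr => t _ /=.
by rewrite -big_mkcond sum1_card; apply: eq_card => s; rewrite !inE.
Qed.

(** A line of the direction of s contains q zeros if it is null, at most k
  otherwise. *)
Lemma zero_count_le k P : (forall i, (k < i)%N -> P`_i = 0) ->
  (zero_count P <= #|null_lines P| * q + (q - #|null_lines P|) * k)%N.
Proof.
move=> Pk; rewrite zero_count_slices (bigID (mem (null_lines P))) /=.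
apply: leq_add.
  by rewrite -sum_nat_const; apply: leq_sum => t _; apply: max_card.
have -> : (q - #|null_lines P| = #|~: null_lines P|)%N by rewrite -(cardsC (null_lines P)) addKn.
rewrite -sum_nat_const (eq_bigl (fun t => t \notin null_lines P)); last by move=> t;
  rewrite inE.
apply: leq_sum => t; rewrite inE => nz.
rewrite (eq_card (B := [set x | (slice P t).[x] == 0%R])); last first.
  by move=> s; rewrite !inE horner_slice.
apply: card_poly_roots => //; apply/leq_sizeP => i ki.
by rewrite coef_slice Pk // horner0.
Qed.

End FiniteCount.

(** * Bases of lines and planes *)

Lemma rank_step (F : fieldType) n m k (A : 'M[F]_(m, n)) (B : 'M[F]_(k, n)) (w : 'rV[F]_n) :
  (A <= B)%MS -> \rank B = (\rank A).+1 -> (w <= B)%MS -> ~~ (w <= A)%MS ->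
  (B :=: A + w)%MS.
Proof.
move=> AB rk wB wA; apply: eqmx_sym; apply/eqmxP.
have sub : (A + w <= B)%MS by rewrite addsmx_sub AB.
rewrite -(geq_leqif (mxrank_leqif_eq sub)) rk ltnNge; apply: contra wA => le.
have sA : (A <= A + w)%MS := addsmxSl _ _.
have /eqmxP -> : (A == A + w)%MS by rewrite -(geq_leqif (mxrank_leqif_eq sA)).
exact: addsmxSr.
Qed.

Lemma sub_add_row (F : fieldType) n m (A : 'M[F]_(m, n)) (w x : 'rV[F]_n) :
  (x <= A + w)%MS -> exists2 v : 'rV_n, (v <= A)%MS & exists c, x = v + c *: w.
Proof.
case/sub_addsmxP => -[u1 u2] /= ->; exists (u1 *m A); first exact: submxMl.
by exists (u2 0 0); rewrite {1}[u2]mx11_scalar mul_scalar_mx.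
Qed.

Lemma row_free_col_mx1 (F : fieldType) m n (L : 'M[F]_(m, n)) (w : 'rV[F]_n) :
  row_free L -> ~~ (w <= L)%MS -> row_free (col_mx L w).
Proof.
move=> Lf wL; apply: inj_row_free => y.
rewrite -[y]hsubmxK mul_row_col [rsubmx y]mx11_scalar mul_scalar_mx.
set c := rsubmx y 0 0 => E; have [c0|c0] := eqVneq c 0.
  move: E; rewrite c0 scale0r addr0 => /eqP; rewrite mulmx_free_eq0 // => /eqP ->.
  by rewrite raddf0 row_mx0.
case/negP: wL; rewrite -(scale1r w) -(mulVf c0) -scalerA scalemx_sub //.
by rewrite -[c *: w](addKr (lsubmx y *m L)) E addr0 -mulNmx submxMl.
Qed.

Lemma row_free_row (F : fieldType) n (e : 'rV[F]_n) : e != 0 -> row_free e.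
Proof. by rewrite /row_free rank_rV => ->. Qed.

Lemma line_basis (F : fieldType) n (L : 'M[F]_(2, n)) (e : 'rV[F]_n) : row_free L ->
  (e <= L)%MS -> e != 0 -> exists e2 : 'rV_n, (col_mx e e2 :=: L)%MS.
Proof.
move=> Lf eL e0.
have [i Li] : exists i, ~~ (row i L <= e)%MS.
  apply/existsP; rewrite -negb_forall; apply: contraT; rewrite negbK => /forallP H.
  have /mxrankS : (L <= e)%MS by apply/row_subP.
  by rewrite (eqP Lf) rank_rV e0.
exists (row i L); apply: eqmx_trans (eqmx_sym (addsmxE _ _)) (eqmx_sym _).
by apply: rank_step => //; rewrite ?row_sub // (eqP Lf) rank_rV e0.
Qed.

Lemma eqmx_row_free2 (F : fieldType) n (L : 'M[F]_(2, n)) (a b : 'rV[F]_n) : row_free L ->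
  (col_mx a b :=: L)%MS -> row_free (col_mx a b).
Proof. by move=> Lf E; rewrite /row_free E (eqP Lf). Qed.

Lemma sub_col2 (F : fieldType) n (a b : 'rV[F]_n) s t :
  ((s *: a + t *: b)%R <= col_mx a b)%MS.
Proof.
by rewrite addmx_sub // -addsmxE scalemx_sub // ?addsmxSl ?addsmxSr.
Qed.

Lemma sub_col2P (F : fieldType) n (a b u : 'rV[F]_n) :
  (u <= col_mx a b)%MS -> exists s t, u = s *: a + t *: b.
Proof.
case/submxP => y ->; exists (lsubmx y 0 0), (rsubmx y 0 0).
by rewrite -{1}[y]hsubmxK mul_row_col {1}[lsubmx y]mx11_scalar
  {1}[rsubmx y]mx11_scalar !mul_scalar_mx.
Qed.

Lemma row_free_col2_neq0 (F : fieldType) n (a b : 'rV[F]_n) : row_free (col_mx a b) -> a != 0.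
Proof.
apply: contraTneq => ->; rewrite /row_free -addsmxE adds0mx.
by have := rank_leq_row b; case: (\rank b) => [|[]].
Qed.

(** * Counting points of subspaces *)

Section Subspaces.

Variables (F : finFieldType) (n : nat).
Local Notation q := #|F|.
Local Notation V := 'rV[F]_n.

Definition points m (A : 'M[F]_(m, n)) : {set V} := [set v | (v <= A)%MS].

Lemma card_points m (A : 'M[F]_(m, n)) : #|points A| = (q ^ \rank A)%N.
Proof.
rewrite -(mul1n (\rank A)) -card_mx.
have inj : injective (fun y : 'rV_(\rank A) => y *m row_base A).
  by apply: row_free_inj; apply: row_base_free.
rewrite -(card_imset _ inj); apply: eq_card => v.
rewrite inE -(eq_row_base A); apply/idP/imsetP => [/submxP [y ->]|[y _ ->]].
  by exists y.
exact: submxMl.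
Qed.

Lemma sub_addr m (A : 'M[F]_(m, n)) (u v : V) : (u <= A)%MS ->
  ((v + u)%R <= A)%MS = (v <= A)%MS.
Proof.
move=> uA; apply/idP/idP => [H|vA]; last exact: addmx_sub.
by rewrite -[v](addrK u) addmx_sub // eqmx_opp.
Qed.

Lemma sum_shift (G : V -> nat) (u : V) m (A : 'M[F]_(m, n)) : (u <= A)%MS ->
  (\sum_(v in points A) G (v + u)%R = \sum_(v in points A) G v)%N.
Proof.
move=> uA; rewrite [RHS](reindex_inj (addIr u)) /=.
by apply: eq_bigl => v; rewrite !inE sub_addr.
Qed.

Variable Z : pred V.

Definition zeros m (T : 'M[F]_(m, n)) := #|[set v in points T | Z v]|.

(** For Z the zero set of p and L a line of X, this counts the points off L in the
  plane spanned by L and w. *)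
Definition fiber m (L : 'M[F]_(m, n)) w := #|[set u in points L | Z (w + u)]|.

Lemma fiberE m (L : 'M[F]_(m, n)) w : fiber L w = (\sum_(u in points L) Z (w + u)%R)%N.
Proof.
rewrite /fiber -sum1dep_card -big_mkcondr /=.
by apply: eq_bigl => u; rewrite inE.
Qed.

Lemma zerosE m (T : 'M[F]_(m, n)) : zeros T = (\sum_(v in points T) Z v)%N.
Proof.
rewrite /zeros -sum1dep_card -big_mkcondr /=.
by apply: eq_bigl => u; rewrite inE.
Qed.

Lemma sum_fiber m k (L : 'M[F]_(m, n)) (T : 'M[F]_(k, n)) : (L <= T)%MS ->
  (\sum_(w in points T) fiber L w = q ^ \rank L * zeros T)%N.
Proof.
move=> LT; under eq_bigr => w _ do rewrite fiberE.
rewrite exchange_big /= -card_points -sum_nat_const; apply: eq_bigr => u.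
rewrite inE => uL; rewrite zerosE (sum_shift (fun v => Z v : nat)) //.
exact: submx_trans uL LT.
Qed.

Lemma fiber_shift m (L : 'M[F]_(m, n)) w u : (u <= L)%MS -> fiber L (w + u) = fiber L w.
Proof.
move=> uL; rewrite !fiberE -(sum_shift (fun v => Z (w + v) : nat) uL).
by apply: eq_bigr => v _; rewrite -addrA [u + v]addrC.
Qed.

Lemma eq_fiber m k (L : 'M[F]_(m, n)) (L' : 'M[F]_(k, n)) w : (L :=: L')%MS ->
  fiber L w = fiber L' w.
Proof. by move=> E; apply: eq_card => u; rewrite !inE E. Qed.

Lemma fiber_le m (L : 'M[F]_(m, n)) w : (fiber L w <= q ^ \rank L)%N.
Proof.
by rewrite -card_points; apply/subset_leq_card/subsetP => u; rewrite inE => /andP [].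
Qed.

Lemma fiber_plane (a b : V) w : row_free (col_mx a b) ->
  fiber (col_mx a b) w = #|[set x : F * F | Z (w + (x.1 *: a + x.2 *: b))]|.
Proof.
move=> ab; pose h (x : F * F) := x.1 *: a + x.2 *: b.
have hE x : h x = row_mx x.1%:M x.2%:M *m col_mx a b :> 'rV_n.
  by rewrite mul_row_col !mul_scalar_mx.
have inj : injective h.
  move=> x y; rewrite !hE => /(row_free_inj ab) /eq_row_mx [] /rowP /(_ 0) E1 /rowP /(_ 0).
  by move: E1; rewrite !mxE !mulr1n; case: x y => [? ?] [? ?] /= -> ->.
rewrite -(card_imset _ inj); apply: eq_card => u; rewrite !inE.
apply/andP/imsetP => [[/submxP [y ->] Zu]|[x]].
  exists (lsubmx y 0 0, rsubmx y 0 0); rewrite ?inE /=.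
    have := hE (lsubmx y 0 0, rsubmx y 0 0).
    by rewrite /h /= -!mx11_scalar hsubmxK => ->.
  by rewrite hE -!mx11_scalar hsubmxK.
by rewrite inE => Zx ->; rewrite hE submxMl -hE.
Qed.

Lemma fiber_line (e : V) w : e != 0 ->
  fiber e w = #|[set s : F | Z (w + s *: e)]|.
Proof.
move=> e0; have inj : injective (fun s : F => s *: e).
  by move=> s t /eqP; rewrite -subr_eq0 -scalerBl scaler_eq0 (negPf e0) orbF subr_eq0 => /eqP.
rewrite -(card_imset _ inj); apply: eq_card => u; rewrite !inE.
apply/andP/imsetP => [[/sub_rVP [s ->] Zu]|[s]].
  by exists s; rewrite ?inE.
by rewrite inE => Zx ->; rewrite scalemx_sub.
Qed.

End Subspaces.

(** Each projective point has q - 1 representatives; the zero vector is the extra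
  zero. *)
Lemma card_cone_zeros (F : finFieldType) n d (f : {mpoly F[n]}) : (0 < d)%N ->
  f \is d.-homog ->
  #|[set v : 'rV[F]_n | f.@[v 0] == 0]| = ((#|F| - 1) * #|rational_points f|).+1.
Proof.
move=> d0 fh; set A := [set v | _].
rewrite (cardsD1 0) inE (meval_at0 _ fh) // eqxx add1n; congr S.
have AE : A :\ 0 = [set v | lies_on f v] by apply/setP => v; rewrite !inE.
rewrite AE /rational_points -sum1_card.
set h := fun v : 'rV_n => (<<v>>%MS : 'M[F]_n).
rewrite (partition_big_imset h) /= mulnC -sum_nat_const.
have -> : [set h v | v in [set v | lies_on f v]] = [set h v | v : 'rV[F]_n & lies_on f v].
  by apply/setP => M; apply/imsetP/imsetP => -[v]; rewrite ?inE => H ->; exists v; rewrite ?inE.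
apply: eq_bigr => M /imsetP [v]; rewrite inE => fv ->.
have v0 : v != 0 by case/andP: fv.
have inj : injective (fun s : F => s *: v).
  by move=> s t /eqP; rewrite -subr_eq0 -scalerBl scaler_eq0 (negPf v0) orbF subr_eq0 => /eqP.
rewrite sum1dep_card -[RHS](_ : #|[set s : F | s != 0]| = _); last first.
  by rewrite -cardsT (cardsD1 0 setT) inE add1n subn1; apply: eq_card => s; rewrite !inE andbT.
rewrite -[RHS](card_imset _ inj); apply: eq_card => u; rewrite !inE.
apply/andP/imsetP => [[fu /eqP E]|[s]].
  have : (u <= v)%MS by rewrite -(genmxE v) -[<<v>>%MS]E genmxE.
  case/sub_rVP => s us; exists s => //; rewrite inE.
  by apply: contraTneq fu => s0; rewrite us s0 scale0r /lies_on eqxx.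
rewrite inE => s0 ->; split.
  by case/andP: fv => _ /eqP fv; rewrite /lies_on scaler_eq0 negb_or s0 v0 (meval_scale _ _ fh) fv mulr0 /=.
by apply/eqP/genmxP; apply/eqmxP; apply: eqmx_scale.
Qed.

(** * Plane sections through a line of the threefold *)

(** The bound falls short of (r + 1) q by j (r + 1 - j), which is smallest, among
  0 < j < r + 1, at the two ends. *)
Lemma defect_arith q r j z : (0 < j)%N -> (j <= r)%N -> (r.+2 <= q)%N ->
  (z <= j * q + (q - j) * (r.+1 - j))%N -> (z + r <= r.+1 * q)%N.
Proof.
move=> j0 jr rq; have [k rk] : exists k, r = (j + k)%N by exists (r - j)%N; lia.
have [l ql] : exists l, q = (j + l)%N by exists (q - j)%N; lia.
rewrite rk ql; have -> : ((j + l - j) = l)%N by lia.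
have -> : (((j + k).+1 - j) = k.+1)%N by lia.
nia.
Qed.

Section LineInX.

Variables (F : finFieldType) (K : closedFieldType) (iota : {rmorphism F -> K}).
Variables (r : nat) (p : {mpoly F[5]}).
Hypotheses (hp : p \is r.+2.-homog) (hq : (r.+2 <= #|F|)%N).
Hypothesis hns : nonsingular iota p.
Local Notation q := #|F|.
Local Notation V := 'rV[F]_5.
Local Notation ev v := (p.@[fun_of_matrix v 0]).

Definition vanish : pred V := fun v => ev v == 0.

Variable L : 'M[F]_(2, 5).
Hypotheses (Lf : row_free L) (LX : forall u : V, (u <= L)%MS -> ev u = 0).

(** The w for which the derivative of p in direction w vanishes on all of M, that
  is, the intersection of the tangent spaces at the rational points of M. *)
Definition polar (M : 'M[F]_(2, 5)) : 'M[F]_5 :=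
  kermx (\matrix_(i < 5, k < #|{:'rV[F]_2}|) (p^`M(i)).@[(enum_val k *m M) 0]).

Lemma sub_polarP (w : V) :
  reflect (forall u : V, (u <= L)%MS -> dirder p w u = 0) (w <= polar L)%MS.
Proof.
rewrite sub_kermx; apply: (iffP eqP) => [H u /submxP [y ->]|H].
  move/rowP/(_ (enum_rank y)): H; rewrite !mxE => H; rewrite -[RHS]H.
  by apply: eq_bigr => i _; rewrite mxE enum_rankK.
apply/rowP => k; rewrite !mxE -[RHS](H (enum_val k *m L)) ?submxMl //.
by apply: eq_bigr => i _; rewrite mxE.
Qed.

Lemma line_sub_polar : (L <= polar L)%MS.
Proof.
apply/row_subP => i; apply/sub_polarP => u uL.
have P0 : line_poly p u (row i L) = 0.
  apply: poly_fin_eq0 => [|s].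
    apply/leq_sizeP => j; apply: contraTeq => cj; rewrite -ltnNge.
    have : (j < r.+3)%N.
      by rewrite ltnNge; apply: contra cj => /(leq_trans (size_line_poly _ _ hp)) H;
        rewrite nth_default.
    rewrite ltnS leq_eqVlt => /predU1P [E|jr]; last exact: leq_trans jr hq.
    by move: cj; rewrite E (coef_line_top _ _ hp) LX ?eqxx // row_sub.
  by rewrite horner_line LX // addmx_sub // scalemx_sub // row_sub.
by rewrite -coef_line1 P0 coef0.
Qed.

Lemma rank_polar_ge : (1 < \rank (polar L))%N.
Proof. by have := mxrankS line_sub_polar; rewrite (eqP Lf). Qed.

Lemma rank_polar_le : (\rank (polar L) <= 3)%N.
Proof.
rewrite /polar mxrank_ker; set M := \matrix_(i, k) _.
suff : (1 < \rank M)%N by lia.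
rewrite ltnNge; apply/negP => M1.
have H (i0 : 'I_5) : (forall i, (row i M <= row i0 M)%MS) -> False.
  move=> H; apply: (nonsingular_line_rank hp hq hns Lf (i0 := i0)) => [y|i].
    by rewrite LX // submxMl.
  have /sub_rVP [z Ez] := H i; exists z => y.
  by move/rowP/(_ (enum_rank y)): Ez; rewrite !mxE enum_rankK.
have [/existsP [i0 Mi0]|] := boolP [exists i, row i M != 0].
  apply: (H i0) => i; apply: submx_trans (row_sub i M) _.
  have := row_sub i0 M; move/mxrank_leqif_eq/geq_leqif.
  by rewrite rank_rV Mi0 M1 => /esym /andP [].
rewrite negb_exists => /forallP M0; apply: (H 0) => i.
by have := M0 i; rewrite negbK => /eqP ->; apply: sub0mx.
Qed.

Lemma plane_not_contained (w : V) : ~~ (w <= L)%MS ->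
  exists2 u : V, (u <= L)%MS & ev (w + u) != 0.
Proof.
move=> wL; apply/exists_inP; apply: contraT => /exists_inPn H; exfalso.
have Mf := row_free_col_mx1 Lf wL.
suff p0 (y : 'rV_(2 + 1)) : ev (y *m col_mx L w) = 0.
  exact: (nonsingular_no_plane hp hq hns Mf p0).
rewrite -[y]hsubmxK mul_row_col [rsubmx y]mx11_scalar mul_scalar_mx.
set c := rsubmx y 0 0; have [c0|c0] := eqVneq c 0.
  by rewrite c0 scale0r addr0 LX // submxMl.
have -> : lsubmx y *m L + c *: w = c *: (w + c^-1 *: (lsubmx y *m L)).
  by rewrite scalerDr scalerA mulfV // scale1r addrC.
rewrite (meval_scale _ _ hp); apply/eqP; rewrite mulf_eq0; apply/orP; right.
by have := H (c^-1 *: (lsubmx y *m L)) (scalemx_sub _ (submxMl _ _)); rewrite negbK.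
Qed.

Section Plane.

Variables (a b w : V).
Hypothesis abL : (col_mx a b :=: L)%MS.
Hypothesis wL : ~~ (w <= L)%MS.

Local Notation Phi := (plane_poly p w a b).

Lemma plane_line s t : ev (s *: a + t *: b) = 0.
Proof. by apply: LX; rewrite -abL sub_col2. Qed.

(** The part of degree d is the restriction of p to L, which is zero. *)
Lemma plane_tdeg : tdeg r.+1 Phi.
Proof.
apply: tdeg_lower; [exact: tdeg_plane|exact: hq|] => s t.
by rewrite diag_plane (coef_line_top _ _ hp) plane_line.
Qed.

(** On the line at infinity L the residual curve is cut out by the derivative of p
  in direction w. *)
Lemma plane_diag s t : diag r.+1 Phi s t = dirder p w (s *: a + t *: b).
Proof. by rewrite diag_plane (coef_line_subtop _ _ hp). Qed.

Lemma plane_neq0 : Phi != 0.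
Proof.
have [u] := plane_not_contained wL; rewrite -abL => /sub_col2P [s [t ->]].
by apply: contraNneq => P0; rewrite -ev2_plane P0 /ev2 !horner0.
Qed.

Lemma fiber_zero_count : fiber vanish L w = zero_count Phi.
Proof.
rewrite -(eq_fiber _ _ abL) fiber_plane; last exact: eqmx_row_free2 abL.
by apply: eq_card => x; rewrite !inE ev2_plane.
Qed.

Lemma zero_count_tdeg m (P : {poly {poly F}}) : tdeg m P -> P != 0 ->
  (zero_count P <= #|null_lines P| * q + (q - #|null_lines P|) * (m - #|null_lines P|))%N.
Proof.
move=> Pm P0; have jm := card_null_lines Pm P0.
apply: zero_count_le => i ij; apply: (null_lines_coef0 Pm).
by rewrite addnC -ltn_subLR.
Qed.

(** For w in the polar space the residual curve contains L, so its affine part has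
  degree only d - 2. *)
Lemma fiber_polar_bound : (w <= polar L)%MS -> (fiber vanish L w <= r * q)%N.
Proof.
move=> /sub_polarP wp; have td : tdeg r Phi.
  apply: tdeg_lower plane_tdeg _ _ => [|s t]; first exact: ltnW.
  by rewrite plane_diag wp // -abL sub_col2.
rewrite fiber_zero_count.
have := zero_count_tdeg td plane_neq0; have := card_null_lines td plane_neq0.
move: hq; nia.
Qed.

Lemma fiber_bound : (fiber vanish L w <= r.+1 * q)%N.
Proof.
rewrite fiber_zero_count.
have := zero_count_tdeg plane_tdeg plane_neq0.
have := card_null_lines plane_tdeg plane_neq0.
move: hq; nia.
Qed.

Lemma null_lines_full : #|null_lines Phi| = r.+1 -> (r.+1 * q <= fiber vanish L w)%N.
Proof.
move=> <-; rewrite fiber_zero_count zero_count_slices [in leqRHS](bigID (mem (null_lines Phi))) /=.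
rewrite -sum_nat_const; apply: leq_trans (leq_addr _ _); apply: leq_sum => t tJ.
rewrite -cardsT; apply/subset_leq_card/subsetP => s _; rewrite inE.
by have /(_ tJ s) -> := elimT (null_linesP t plane_tdeg hq).
Qed.

(** Parallel lines in direction a: with none, the degree in that direction drops to
  r, because a is at infinity on the curve; with r + 1, the plane is full;
  anything in between is handled by [defect_arith]. *)
Lemma fiber_defect : dirder p w a = 0 -> (fiber vanish L w < r.+1 * q)%N ->
  (fiber vanish L w + r <= r.+1 * q)%N.
Proof.
move=> wa lt; have jr := card_null_lines plane_tdeg plane_neq0.
have ne : #|null_lines Phi| != r.+1.
  by apply: contraTneq lt => /null_lines_full; rewrite -leqNgt.
have [j0|j0] := posnP #|null_lines Phi|; last first.
  move: jr; rewrite leq_eqVlt (negPf ne) /= ltnS => jr.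
  have := zero_count_tdeg plane_tdeg plane_neq0; rewrite -fiber_zero_count.
  exact: defect_arith.
have top i : (r < i)%N -> Phi`_i = 0.
  rewrite leq_eqVlt => /predU1P [<-|ri]; last first.
    by apply/polyP => j; rewrite coef0 plane_tdeg // ltn_addr.
  apply/polyP => -[|j]; rewrite coef0; last by rewrite plane_tdeg // addnS ltnS leq_addr.
  have := plane_diag 1 0; rewrite scale1r scale0r addr0 wa /diag big_ord_recr /=.
  rewrite subnn expr0 expr1n !mul1r big1 ?add0r // => k _.
  by rewrite expr0n subn_eq0 leqNgt ltn_ord mulr0 mul0r.
have := zero_count_le top; rewrite -fiber_zero_count j0.
move: hq; nia.
Qed.

(** One line in direction a forces r + 1 of them by counting, and then the equation
  depends on t alone. *)
Lemma full_plane_direction : (0 < #|null_lines Phi|)%N -> (r.+1 * q <= fiber vanish L w)%N ->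
  (forall s t, ev (w + (s *: a + t *: b)) = ev (w + t *: b)) /\
  exists c, forall s t, dirder p w (s *: a + t *: b) = c * t ^+ r.+1.
Proof.
move=> j0 full; have jr := card_null_lines plane_tdeg plane_neq0.
have jE : #|null_lines Phi| = r.+1.
  apply/eqP; rewrite eqn_leq jr leqNgt; apply/negP => lt.
  have := zero_count_tdeg plane_tdeg plane_neq0; rewrite -fiber_zero_count.
  move: hq; nia.
have hi i : (0 < i)%N -> Phi`_i = 0.
  by move=> i0; apply: (null_lines_coef0 plane_tdeg); rewrite jE -add1n leq_add2r.
have PhiE : Phi = (Phi`_0)%:P.
  by apply/polyP => -[|i]; rewrite coefC //= hi.
split=> [s t|].
  have := ev2_plane p w a b 0 t; rewrite scale0r add0r => <-.
  by rewrite -ev2_plane PhiE /ev2 !hornerC.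
exists (Phi`_0`_r.+1) => s t.
rewrite -plane_diag /diag big_ord_recl /= big1 ?addr0 => [|i _].
  by rewrite expr0 mul1r subn0 mulrC.
by rewrite hi // coef0 mulr0.
Qed.

End Plane.

End LineInX.

(** * Planes without defect and the cones they generate *)

Section FullPlanes.

Variables (F : finFieldType) (K : closedFieldType) (iota : {rmorphism F -> K}).
Variables (r : nat) (p : {mpoly F[5]}).
Hypotheses (hp : p \is r.+2.-homog) (hq : (r.+2 <= #|F|)%N).
Hypothesis hns : nonsingular iota p.
Local Notation q := #|F|.
Local Notation V := 'rV[F]_5.
Local Notation ev v := (p.@[fun_of_matrix v 0]).
Local Notation vanish := (vanish p).

(** Comparing, for each t, polynomials of degree less than q in s (the coefficient
  of degree d is p e = 0), all coefficients of positive degree in s vanish, first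
  for each t and then as polynomials in t, again by degree.  The part of degree d
  of the equation is thus independent of s as well; it is the restriction of p to
  the span of e and v. *)
Lemma invariant_at_infinity (w e v : V) : ev e = 0 ->
  (forall s t, ev (w + (s *: e + t *: v)) = ev (w + t *: v)) ->
  forall s, ev (v + s *: e) = ev v.
Proof.
move=> e0 inv; set Phi := plane_poly p w e v.
have td : tdeg r.+2 Phi by apply: tdeg_plane.
have hi i : (0 < i)%N -> Phi`_i = 0.
  move=> i0; apply: poly_fin_eq0 => [|t].
    by apply: leq_trans (tdeg_coef_size i td) _;
      rewrite (leq_trans _ hq) // leq_subLR -add1n leq_add2r.
  pose Q := slice Phi t - (slice Phi t).[0]%:P.
  have Q0 : Q = 0.
    apply: poly_fin_eq0 => [|s]; last first.
      by rewrite !hornerE !horner_slice !ev2_plane !inv subrr.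
    apply: leq_trans hq; apply/leq_sizeP => j; rewrite coefB coefC.
    case: j => [//|j] /=; rewrite subr0 coef_slice leq_eqVlt => /predU1P [<-|jr].
      suff -> : Phi`_r.+2 = 0 by rewrite horner0.
      apply/polyP => -[|k]; rewrite coef0; last by rewrite td // addnS ltnS leq_addr.
      have := diag_plane p w e v 1 0 r.+2;
        rewrite scale1r scale0r addr0 (coef_line_top _ _ hp) e0.
      rewrite /diag big_ord_recr /= subnn expr0 expr1n !mul1r big1 ?add0r // => k _.
      by rewrite expr0n subn_eq0 leqNgt ltn_ord mulr0 mul0r.
    suff -> : Phi`_j.+1 = 0 by rewrite horner0.
    by apply/polyP => k; rewrite coef0 td // ltn_addr.
  have := congr1 (fun R : {poly F} => R`_i) Q0.
  by rewrite /= coefB coefC gtn_eqF // subr0 coef0 coef_slice.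
have top s : ev (v + s *: e) = Phi`_0`_r.+2.
  have := diag_plane p w e v s 1 r.+2; rewrite scale1r (coef_line_top _ _ hp) addrC => <-.
  rewrite /diag big_ord_recl /= big1 ?addr0 => [|i _]; last by rewrite hi // coef0 mulr0.
  by rewrite expr0 expr1n !mul1r subn0.
by move=> s; rewrite top -[v in RHS]addr0 -(scale0r e) top.
Qed.

Lemma fiber_scale m (L : 'M[F]_(m, 5)) c w : c != 0 ->
  fiber vanish L (c *: w) = fiber vanish L w.
Proof.
move=> c0; rewrite /fiber -(card_imset [set u in points L | vanish (w + u)] (scalerI c0)).
apply: eq_card => u; rewrite !inE; apply/andP/imsetP => [[uL Zu]|[x]].
  exists (c^-1 *: u); last by rewrite scalerA mulfV // scale1r.
  rewrite !inE scalemx_sub //=; move: Zu.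
  rewrite (_ : c *: w + u = c *: (w + c^-1 *: u)).
    by rewrite /vanish (meval_scale _ _ hp) mulf_eq0 expf_eq0 (negPf c0) andbF.
  by rewrite scalerDr scalerA mulfV // scale1r.
rewrite !inE => /andP [xL /eqP Zx] ->; rewrite scalemx_sub // -scalerDr.
by rewrite /vanish (meval_scale _ _ hp) Zx mulr0.
Qed.

Variable L : 'M[F]_(2, 5).
Hypotheses (Lf : row_free L) (LX : forall u : V, (u <= L)%MS -> ev u = 0).

Local Notation nf w := (fiber vanish L w).

(** If no line of the affine plane lay in X, each of the q + 1 lines through a
  point o of X would contain at most r further points, giving at most
  1 + (q + 1) r points, less than (r + 1) q since r + 1 < q. *)
Lemma full_plane_has_line (w : V) : ~~ (w <= L)%MS -> (r.+1 * q <= nf w)%N ->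
  exists e u : V, [/\ (e <= L)%MS, e != 0, (u <= L)%MS &
    forall s, ev (w + u + s *: e) = 0].
Proof.
move=> wL full.
have [/existsP [e /existsP [u /and4P [eL e0 uL /forallP H]]]|] := boolP
  [exists e : V, [exists u : V, [&& (e <= L)%MS, e != 0, (u <= L)%MS &
     [forall s, ev (w + u + s *: e) == 0]]]].
  by exists e, u; split=> // s; apply/eqP.
move/existsPn => H; exfalso.
have : (0 < nf w)%N by rewrite (leq_trans _ full) // muln_gt0 /= (leq_trans _ hq).
case/card_gt0P => u; rewrite !inE => /andP [uL /eqP ou].
set o := w + u in ou.
have nfo : nf o = nf w by apply: fiber_shift.
pose S (e : V) := [set s : F | (s != 0) && (ev (o + s *: e) == 0)].
pose E := points L :\ 0.
have SE e : e \in E -> (#|S e| <= r)%N.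
  rewrite !inE => /andP [e0 eL].
  have P0 : line_poly p o e != 0.
    apply/negP => /eqP P0; have /existsPn /(_ u) /negP := H e; apply.
    by rewrite eL e0 uL; apply/forallP => s; rewrite -horner_line P0 horner0.
  have sP : (size (line_poly p o e) <= r.+2)%N.
    have sz := size_line_poly o e hp; apply/leq_sizeP => j.
    rewrite leq_eqVlt => /predU1P [<-|jr]; first by rewrite (coef_line_top _ _ hp) LX.
    by rewrite nth_default // (leq_trans sz).
  have := card_poly_roots P0 sP; rewrite (cardsD1 0) inE horner_line scale0r addr0 ou eqxx.
  rewrite add1n ltnS; apply: leq_trans; apply/subset_leq_card/subsetP => s.
  by rewrite !inE horner_line.
have cE : #|E| = (q ^ 2 - 1)%N.
  by have := cardsD1 0 (points L); rewrite inE sub0mx card_points (eqP Lf) add1n => ->;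
    rewrite subn1.
have sum1 : (\sum_(e in E) #|S e| <= (q ^ 2 - 1) * r)%N.
  by rewrite -cE -sum_nat_const; apply: leq_sum.
have sum2 : (\sum_(e in E) #|S e| = (q - 1) * (nf w - 1))%N.
  have SE2 e : #|S e| = (\sum_(s : F | s != 0%R) (ev (o + s *: e)%R == 0%R))%N.
    by rewrite /S -sum1dep_card [in RHS]big_mkcond /= big_mkcond /=; apply: eq_bigr => s _;
      case: eqP; case: eqP.
  rewrite (eq_bigr _ (fun e _ => SE2 e)) exchange_big /=.
  have -> : (q - 1 = #|[set s : F | s != 0%R]|)%N.
    by rewrite -cardsT (cardsD1 0 setT) inE add1n subn1; apply: eq_card => s;
      rewrite !inE andbT.
  rewrite -sum1dep_card big_distrl /=; apply: eq_bigr => s s0; rewrite mul1n.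
  have -> : (nf w - 1 = \sum_(e in E) (ev (o + e)%R == 0%R))%N.
    rewrite -nfo fiberE (bigD1 0) ?inE ?sub0mx //= addr0 /vanish ou eqxx add1n subn1 /=.
    by apply: eq_bigl => e; rewrite !inE andbC.
  rewrite [RHS](reindex_inj (scalerI s0)) /=; apply: eq_bigl => e.
  by rewrite !inE scaler_eq0 negb_or s0 /= (eqmx_scale _ s0).
have q1 : (0 < q - 1)%N by rewrite subn_gt0 (leq_trans _ hq).
move: sum1; rewrite sum2 (_ : q ^ 2 - 1 = (q - 1) * (q + 1))%N; last first.
  by rewrite (subn_sqr q 1).
rewrite -mulnA leq_pmul2l // => Hle.
by clear -Hle full hq; nia.
Qed.

Lemma dirder_polar (w v u : V) : (v <= polar p L)%MS -> (u <= L)%MS ->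
  dirder p (w + v) u = dirder p w u.
Proof. by move=> /sub_polarP vp uL; rewrite dirderD vp // addr0. Qed.

Lemma notin_polar (w : V) : ~~ (w <= polar p L)%MS -> ~~ (w <= L)%MS.
Proof.
by apply: contra => wL; apply: submx_trans wL (line_sub_polar hp hq LX).
Qed.

(** The direction e is that of the parallel lines; dp/dw is then the pure power
  c t^(r + 1). *)
Lemma full_plane (w : V) : ~~ (w <= polar p L)%MS -> (r.+1 * q <= nf w)%N ->
  exists e e2 c, [/\ (col_mx e e2 :=: L)%MS, c != 0,
    forall s t, ev (w + (s *: e + t *: e2)) = ev (w + t *: e2)
  & forall s t, dirder p w (s *: e + t *: e2) = c * t ^+ r.+1].
Proof.
move=> wp full; have wL := notin_polar wp.
have [e [u [eL e0 uL H]]] := full_plane_has_line wL full.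
have [e2 E] := line_basis Lf eL e0.
have [s0 [t0 uE]] : exists s t, u = s *: e + t *: e2.
  by apply: sub_col2P; rewrite E.
have j0 : (0 < #|null_lines (plane_poly p w e e2)|)%N.
  apply/card_gt0P; exists t0.
  apply/(null_linesP t0 (plane_tdeg hp hq LX w E) hq) => s.
  rewrite ev2_plane -[RHS](H (s - s0)) uE; congr (ev _).
  by rewrite -!addrA scalerBl; congr (w + _); rewrite [t0 *: e2 + _]addrC addrCA addrA subrK.
have [inv [c Hc]] := full_plane_direction hp hq hns Lf LX E wL j0 full.
exists e, e2, c; split=> //; apply: contra wp => /eqP c0.
apply/sub_polarP => v; rewrite -E => /sub_col2P [s [t ->]].
by rewrite Hc c0 mul0r.
Qed.

Lemma fiber_defect_in (w u : V) : ~~ (w <= L)%MS -> (u <= L)%MS -> u != 0 ->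
  dirder p w u = 0 -> (nf w < r.+1 * q)%N -> (nf w + r <= r.+1 * q)%N.
Proof.
move=> wL uL u0 wu lt; have [e2 E] := line_basis Lf uL u0.
exact: (fiber_defect hp hq hns Lf LX E wL wu lt).
Qed.

Definition full_coset (w : V) :=
  [forall v in points (polar p L), (r.+1 * q <= nf (w + v)%R)%N].

(** All planes of the family share the form dp/dw on L, which vanishes only at e,
  so their lines all have direction e.  The polar space is the plane at infinity
  of the coset, which [invariant_at_infinity] takes care of. *)
Lemma full_coset_invariant (w : V) : ~~ (w <= polar p L)%MS -> full_coset w ->
  exists e e2 : V, [/\ (col_mx e e2 :=: L)%MS, e != 0, dirder p w e = 0
  & forall x : V, (x <= polar p L + w)%MS -> forall s, ev (x + s *: e) = ev x].
Proof.
move=> wp /forall_inP full.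
have fw v : (v <= polar p L)%MS -> (r.+1 * q <= nf (w + v)%R)%N.
  by move=> vp; apply: full; rewrite inE.
have [e [e2 [c [E c0 _ Dw]]]] : exists e e2 c, [/\ (col_mx e e2 :=: L)%MS, c != 0,
    forall s t, ev (w + (s *: e + t *: e2)) = ev (w + t *: e2)
  & forall s t, dirder p w (s *: e + t *: e2) = c * t ^+ r.+1].
  by apply: full_plane => //; have := fw 0 (sub0mx _ _); rewrite addr0.
have we : dirder p w e = 0.
  by have := Dw 1 0; rewrite scale1r scale0r addr0 expr0n mulr0.
have e0 : e != 0 := row_free_col2_neq0 (eqmx_row_free2 Lf E).
have eL : (e <= L)%MS by rewrite -E -addsmxE addsmxSl.
have t0 s t : dirder p w (s *: e + t *: e2) = 0 -> t = 0.
  by rewrite Dw => /eqP; rewrite mulf_eq0 (negPf c0) expf_eq0 => /eqP.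
have inv (v : V) s : (v <= polar p L)%MS -> ev (w + v + s *: e) = ev (w + v).
  move=> vp; have wvp : ~~ ((w + v)%R <= polar p L)%MS by rewrite sub_addr.
  have [e' [e2' [c' [E' c'0 inv' Dw']]]] := full_plane wvp (fw v vp).
  have e'L : (e' <= L)%MS by rewrite -E' -addsmxE addsmxSl.
  have [a [b e'E]] : exists a b, e' = a *: e + b *: e2.
    by apply: sub_col2P; rewrite E.
  have b0 : b = 0.
    apply: (t0 a); rewrite -e'E -(dirder_polar w vp e'L).
    by have := Dw' 1 0; rewrite scale1r scale0r addr0 expr0n mulr0.
  have a0 : a != 0.
    have := row_free_col2_neq0 (eqmx_row_free2 Lf E'); apply: contraNneq => a0.
    by rewrite e'E a0 b0 !scale0r addr0.
  have := inv' (s / a) 0; rewrite scale0r !addr0 e'E b0 scale0r addr0 scalerA.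
  by rewrite -mulrA mulVf // mulr1.
have inv0 (v : V) s : (v <= polar p L)%MS -> ev (v + s *: e) = ev v.
  move=> vp; apply: (invariant_at_infinity (w := w)); first exact: LX.
  move=> a b; rewrite [a *: e + _]addrC addrA; apply: inv; exact: scalemx_sub.
exists e, e2; split=> // x /sub_addsmxP [[u1 u2] /= ->] s.
set v := u1 *m _; have vp : (v <= polar p L)%MS by apply: submxMl.
rewrite [u2]mx11_scalar mul_scalar_mx; set l := u2 0 0.
have [->|l0] := eqVneq l 0; first by rewrite scale0r addr0 inv0.
have -> : v + l *: w + s *: e = l *: (w + l^-1 *: v + (s / l) *: e).
  by rewrite !scalerDr !scalerA mulfV // scale1r mulrCA mulfV // mulr1 [v + _]addrC.
rewrite (meval_scale _ _ hp) inv ?scalemx_sub // -(meval_scale _ _ hp).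
by rewrite scalerDr scalerA mulfV // scale1r addrC.
Qed.

(** A polar vector is tangent at every point of L; ranks do the rest. *)
Lemma tangent_polar (e w : V) : (e <= L)%MS -> e != 0 -> \rank (polar p L) = 3%N ->
  ~~ (w <= polar p L)%MS -> dirder p w e = 0 ->
  (tangent_space p e :=: polar p L + w)%MS.
Proof.
move=> eL e0 rk wp we; apply: rank_step => //.
- apply/rV_subP => v /sub_polarP vp.
  by rewrite sub_tangent vp.
- by rewrite (rank_tangent hns e0 (LX eL)) rk.
by rewrite sub_tangent we.
Qed.

End FullPlanes.

(** * Sums of defects *)

Section Translates.

Variables (F : finFieldType) (n : nat).
Local Notation q := #|F|.
Local Notation V := 'rV[F]_n.

Lemma card_diff_points m k (A : 'M[F]_(m, n)) (B : 'M[F]_(k, n)) : (A <= B)%MS ->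
  #|[set w : V | (w <= B)%MS && ~~ (w <= A)%MS]| = (q ^ \rank B - q ^ \rank A)%N.
Proof.
move=> AB; have := cardsID (points A) (points B).
rewrite (setIidPr _); last by apply/subsetP => v; rewrite !inE => /submx_trans; apply.
rewrite !card_points => <-; rewrite addKn; apply: eq_card => v.
by rewrite !inE andbC.
Qed.

Lemma card_compl_points m (A : 'M[F]_(m, n)) :
  #|[set w : V | ~~ (w <= A)%MS]| = (q ^ n - q ^ \rank A)%N.
Proof.
have := card_diff_points (submx1 A); rewrite mxrank1 => <-.
by apply: eq_card => w; rewrite !inE submx1.
Qed.

Section SumTranslates.

Variables (m : nat) (A : 'M[F]_(m, n)) (S : {set V}) (G : V -> nat) (k : nat).
Hypothesis SA : forall w v : V, (v <= A)%MS -> (w + v \in S) = (w \in S).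
Hypothesis Gk : forall w, w \in S -> (k <= \sum_(v in points A) G (w + v)%R)%N.

Let sum_translates_eq :
  (\sum_(w in S) \sum_(v in points A) G (w + v)%R = q ^ \rank A * \sum_(w in S) G w)%N.
Proof.
rewrite exchange_big /= -card_points -sum_nat_const; apply: eq_bigr => v.
rewrite inE => vA; rewrite [RHS](reindex_inj (addIr v)) /=.
by apply: eq_bigl => w; rewrite SA.
Qed.

Lemma sum_translates : (#|S| * k <= q ^ \rank A * \sum_(w in S) G w)%N.
Proof. by rewrite -sum_translates_eq -sum_nat_const; apply: leq_sum. Qed.

(** The strict form lets equality in the total be traced back to each term. *)
Lemma sum_translates_lt w0 : w0 \in S -> (k < \sum_(v in points A) G (w0 + v)%R)%N ->
  (#|S| * k < q ^ \rank A * \sum_(w in S) G w)%N.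
Proof.
move=> Sw0 Gw0; rewrite -sum_translates_eq -sum_nat_const.
rewrite (bigD1 w0) //= [ltnRHS](bigD1 w0) //= -addSn leq_add //.
by apply: leq_sum => w /andP [Sw _]; apply: Gk.
Qed.

End SumTranslates.

End Translates.

Section Defects.

Variables (F : finFieldType) (K : closedFieldType) (iota : {rmorphism F -> K}).
Variables (r : nat) (p : {mpoly F[5]}).
Hypotheses (hp : p \is r.+2.-homog) (hq : (r.+2 <= #|F|)%N).
Hypothesis hns : nonsingular iota p.
Local Notation q := #|F|.
Local Notation V := 'rV[F]_5.
Local Notation ev v := (p.@[fun_of_matrix v 0]).
Local Notation vanish := (vanish p).

Variable L : 'M[F]_(2, 5).
Hypotheses (Lf : row_free L) (LX : forall u : V, (u <= L)%MS -> ev u = 0).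

Local Notation nf w := (fiber vanish L w).
Local Notation U := (polar p L).

Definition defect (w : V) := (r.+1 * q - nf w)%N.

(** Over vectors rather than planes: each plane through L is counted q^2 (q - 1)
  times. *)
Definition defect_sum := (\sum_(w : V | ~~ (w <= L)%MS) defect w)%N.

(** The total (d - 1) q, in the normalization of [defect_sum]. *)
Definition critical_defect := (r.+1 * q ^ 3 * (q - 1))%N.

Lemma rankL : \rank L = 2%N.
Proof. exact: eqP Lf. Qed.

Lemma cardL : #|points L| = (q ^ 2)%N.
Proof. by rewrite card_points rankL. Qed.

Lemma qgt0 : (0 < q)%N.
Proof. exact: leq_trans hq. Qed.

Lemma fiber_in (w : V) : (w <= L)%MS -> nf w = (q ^ 2)%N.
Proof.
move=> wL; rewrite -[w]add0r fiber_shift // -cardL.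
apply: eq_card => u; rewrite !inE add0r; case: (boolP (u <= L)%MS) => //= uL.
by rewrite /vanish LX ?eqxx.
Qed.

Lemma rowsL : (col_mx (row 0 L) (row 1 L) :=: L)%MS.
Proof.
apply/eqmxP; rewrite -addsmxE addsmx_sub !row_sub /=; apply/row_subP => i.
have [->|->] : i = 0 \/ i = 1.
  by case: i => -[|[|//]] ?; [left|right]; apply: val_inj.
  by rewrite -addsmxE addsmxSl.
by rewrite -addsmxE addsmxSr.
Qed.

Lemma fiberK (w : V) : ~~ (w <= L)%MS -> (nf w + defect w = r.+1 * q)%N.
Proof. by move=> wL; rewrite subnKC // (fiber_bound hp hq hns Lf LX rowsL). Qed.

Lemma defect_shift (w u : V) : (u <= L)%MS -> defect (w + u) = defect w.
Proof. by move=> uL; rewrite /defect fiber_shift. Qed.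

Lemma defect_gt0 (w : V) : ~~ (r.+1 * q <= nf w)%N -> (0 < defect w)%N.
Proof. by rewrite subn_gt0 ltnNge. Qed.

Lemma sum_complL (G : V -> nat) :
  (\sum_(w : V) G w = \sum_(w in points L) G w + \sum_(w : V | ~~ (w <= L)%MS) G w)%N.
Proof.
rewrite (bigID (fun w : V => (w <= L)%MS)) /=; congr addn.
by apply: eq_bigl => w; rewrite inE.
Qed.

Lemma total_defect :
  (q ^ 2 * #|[set v : V | ev v == 0%R]| + defect_sum
   = q ^ 4 + (q ^ 5 - q ^ 2) * (r.+1 * q))%N.
Proof.
have -> : #|[set v : V | ev v == 0]| = zeros vanish (1%:M : 'M_5).
  by apply: eq_card => v; rewrite !inE submx1.
have := sum_fiber vanish (submx1 L); rewrite rankL => <-.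
rewrite (eq_bigl xpredT) => [|v]; last by rewrite inE submx1.
rewrite sum_complL -addnA -big_split /=.
rewrite (eq_bigr (fun=> (q ^ 2)%N)) => [|w]; last by rewrite inE => /fiber_in.
rewrite [X in (_ + X)%N](eq_bigr (fun=> (r.+1 * q)%N)) => [|w]; last exact: fiberK.
rewrite sum_nat_const cardL -expnD; congr addn.
by rewrite sum_nat_cond_const card_compl_points rankL.
Qed.

Lemma polar_defect_ge (w : V) : (w <= U)%MS -> ~~ (w <= L)%MS -> (q <= defect w)%N.
Proof.
move=> wU wL; have := fiber_polar_bound hp hq hns Lf LX rowsL wL wU.
by rewrite /defect; move: (nf w) => k; nia.
Qed.

(** That is, max(1, d - 2): for quadrics d - 2 is zero, yet a plane which is not full
  loses a point. *)
Definition min_defect := maxn 1 r.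

(** If one plane of the coset is full, dp/dw vanishes at a point of L and every
  other plane of the coset which is not full has defect at least [min_defect];
  each vector of L gives a representative of such a plane.  If none is full, the
  q planes of the coset have defect at least 1 each, and q exceeds
  [min_defect]. *)
Lemma coset_defect (w : V) : \rank U = 3%N -> ~~ (w <= U)%MS -> ~~ full_coset r p L w ->
  (q ^ 2 * min_defect <= \sum_(v in points U) defect (w + v)%R)%N.
Proof.
move=> rk wU nfull.
have wvU v : (v <= U)%MS -> ~~ ((w + v)%R <= U)%MS by move=> vU; rewrite sub_addr.
have [/exists_inP [v']|] := boolP [exists v' in points U, (r.+1 * q <= nf (w + v')%R)%N];
  last first.
  move/exists_inPn => H; apply: (@leq_trans (q ^ 3)).
    by rewrite expnS mulnC leq_mul2r geq_max qgt0 (leq_trans _ hq) ?orbT // ltnW.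
  have := card_points U; rewrite rk => <-; rewrite -sum1_card; apply: leq_sum => v vU.
  by apply: defect_gt0; apply: H.
rewrite inE => v'U full'.
have [e [e2 [c [E c0 _ Dw]]]] := full_plane hp hq hns Lf LX (wvU _ v'U) full'.
have eL : (e <= L)%MS by rewrite -E -addsmxE addsmxSl.
have e0 : e != 0 := row_free_col2_neq0 (eqmx_row_free2 Lf E).
have we : dirder p w e = 0.
  rewrite -(dirder_polar w v'U eL).
  by have := Dw 1 0; rewrite scale1r scale0r addr0 expr0n mulr0.
move: nfull; rewrite negb_forall => /existsP [v]; rewrite negb_imply inE => /andP [vU nv].
have dv : (min_defect <= defect (w + v))%N.
  rewrite geq_max defect_gt0 //= leq_subRL; last by rewrite leqNgt; apply: contra nv;
    apply: ltnW.
  apply: (fiber_defect_in hp hq hns Lf LX _ eL e0); last by rewrite ltnNge.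
    by apply: (notin_polar hp hq LX); apply: wvU.
  by rewrite (dirder_polar _ vU eL).
rewrite -(sum_shift (fun x => defect (w + x)) vU).
apply: (@leq_trans (\sum_(u in points L) defect (w + (u + v))%R)).
  rewrite -cardL -sum_nat_const; apply: leq_sum => u; rewrite inE => uL.
  by rewrite [u + v]addrC addrA defect_shift.
rewrite [leqRHS](bigID (mem (points L))) /=; apply: leq_trans (leq_addr _ _).
rewrite [leqRHS](eq_bigl (mem (points L))) // => u; rewrite !inE /=.
apply: andb_idl => uL; exact: submx_trans uL (line_sub_polar hp hq LX).
Qed.

End Defects.

(** * No full family of planes *)

Lemma leq_card_fibers (T T' : finType) (f : T -> T') (A : {set T}) (B : {set T'}) k :
  (forall x, x \in A -> f x \in B) ->
  (forall x, x \in A -> (#|[set y in A | f y == f x]| <= k)%N) ->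
  (#|A| <= #|B| * k)%N.
Proof.
move=> fAB fk; rewrite -sum1_card (partition_big f (mem B)) /=; last exact: fAB.
rewrite -sum_nat_const; apply: leq_sum => y yB.
rewrite sum1dep_card; have [E|[x]] := set_0Vmem [set x in A | f x == y].
  by rewrite E cards0.
by rewrite inE => /andP [xA /eqP <-]; apply: fk.
Qed.

Lemma sum_points_split (F : finFieldType) n m k (A : 'M[F]_(m, n)) (B : 'M[F]_(k, n))
    (G : 'rV[F]_n -> nat) : (A <= B)%MS ->
  (\sum_(v in points B) G v = \sum_(v in points A) G v +
     \sum_(v in [set w : 'rV_n | (w <= B)%MS && ~~ (w <= A)%MS]) G v)%N.
Proof.
move=> AB; rewrite (bigID (fun v : 'rV_n => (v <= A)%MS)) /=; congr addn.
  by apply: eq_bigl => v; rewrite !inE andb_idl // => /submx_trans; apply.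
by apply: eq_bigl => v; rewrite !inE.
Qed.

Section Alternatives.

Variables (F : finFieldType) (K : closedFieldType) (iota : {rmorphism F -> K}).
Variables (r : nat) (p : {mpoly F[5]}).
Hypotheses (hp : p \is r.+2.-homog) (hq : (r.+2 <= #|F|)%N).
Hypothesis hns : nonsingular iota p.
Local Notation q := #|F|.
Local Notation V := 'rV[F]_5.
Local Notation ev v := (p.@[fun_of_matrix v 0]).
Local Notation vanish := (vanish p).

Variable L : 'M[F]_(2, 5).
Hypotheses (Lf : row_free L) (LX : forall u : V, (u <= L)%MS -> ev u = 0).

Local Notation nf w := (fiber vanish L w).
Local Notation U := (polar p L).
Local Notation defect := (defect r p L).
Local Notation defect_sum := (defect_sum r p L).
Local Notation critical := (critical_defect F r).

Lemma card_field_pred : exists2 s, q = s.+1 & (r < s)%N.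
Proof. by case: #|F| hq => // s ?; exists s. Qed.

Definition full_planes : {set V} :=
  [set w | ~~ (w <= L)%MS && (r.+1 * q <= nf w)%N].

(** A full plane determines a pure power c l^(r + 1), up to scalars one for each of
  the q + 1 points of L; as L is its own polar space, w is determined by it
  modulo L. *)
Lemma card_full_planes : \rank U = 2%N ->
  (#|full_planes| <= (q - 1) * (q + 1) * q ^ 2)%N.
Proof.
move=> rk.
have UL : (L == U)%MS.
  rewrite -(geq_leqif (mxrank_leqif_eq (line_sub_polar hp hq LX))) rk.
  by rewrite (rankL Lf).
have {UL}UL : (U :=: L)%MS by apply/eqmx_sym/eqmxP.
pose a := row 0 L; pose b := row 1 L.
pose D w : {ffun F * F -> F} := [ffun x => dirder p w (x.1 *: a + x.2 *: b)].
pose h (x : F * option F) : {ffun F * F -> F} :=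
  [ffun y => x.1 * (if x.2 is Some z then (y.2 - z * y.1) else y.1) ^+ r.+1].
pose B := [set h x | x in setX [set~ 0] setT].
have cB : (#|B| <= (q - 1) * (q + 1))%N.
  apply: leq_trans (leq_imset_card _ _) _.
  by rewrite cardsX cardsT card_option cardsC1 addn1 subn1.
have abE := rowsL L.
apply: leq_trans (leq_mul cB (leqnn _)).
apply: (@leq_card_fibers _ _ D) => [w|w _]; last first.
  rewrite -(cardL Lf) -(card_imset (mem (points L)) (addrI w)).
  apply/subset_leq_card/subsetP => v; rewrite inE => /andP [_ /eqP DE].
  apply/imsetP; exists (v - w); last by rewrite addrC subrK.
  rewrite inE -UL; apply/sub_polarP => u; rewrite -abE => /sub_col2P [s [t ->]].
  have := congr1 (fun f : {ffun F * F -> F} => f (s, t)) DE; rewrite !ffunE /= => E.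
  by rewrite dirderD E -scaleN1r dirderZ mulN1r subrr.
rewrite inE => /andP [wL full].
have wU : ~~ (w <= U)%MS by rewrite UL.
have [e [e2 [c [E c0 _ Dw]]]] := full_plane hp hq hns Lf LX wU full.
have [s1 [t1 aE]] : exists s t, a = s *: e + t *: e2.
  by apply: sub_col2P; rewrite E row_sub.
have [s2 [t2 bE]] : exists s t, b = s *: e + t *: e2.
  by apply: sub_col2P; rewrite E row_sub.
(* The pure power in the fixed coordinates of L; its zero is (1 : 0) when
   t1 = 0, and in general (t2 : - t1). *)
have DE x : D w x = c * (x.1 * t1 + x.2 * t2) ^+ r.+1.
  rewrite ffunE -(Dw (x.1 * s1 + x.2 * s2)); congr dirder.
  by rewrite aE bE !scalerDr !scalerA !scalerDl addrACA.
have [t20|t20] := eqVneq t2 0.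
  have t10 : t1 != 0.
    apply: contra wU => /eqP t10; apply/sub_polarP => u; rewrite -abE => /sub_col2P [s [t ->]].
    by have := DE (s, t); rewrite ffunE /= => ->; rewrite t10 t20 !mulr0 addr0 expr0n mulr0.
  apply/imsetP; exists (c * t1 ^+ r.+1, None); first by rewrite !inE mulf_neq0 // expf_neq0.
  by apply/ffunP => x; rewrite DE ffunE /= t20 mulr0 addr0 exprMn mulrA -mulrA [X in c * X]mulrC mulrA.
apply/imsetP; exists (c * t2 ^+ r.+1, Some (- (t1 / t2))).
  by rewrite !inE mulf_neq0 // expf_neq0.
apply/ffunP => x; rewrite DE ffunE /= -mulrA -exprMn mulrBr mulNr mulrN opprK mulrA.
by rewrite [t2 * (t1 / t2)]mulrC mulfVK // [x.1 * t1]mulrC [x.2 * t2]mulrC addrC.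
Qed.

(** At least q^2 planes remain that are not full, and q^2 > (d - 1) q. *)
Lemma line_polar_defect : \rank U = 2%N -> (critical < defect_sum)%N.
Proof.
move=> rk; have cf := card_full_planes rk.
have H : (#|[set w : V | ~~ (w <= L)%MS]| <= #|full_planes| + defect_sum)%N.
  rewrite /defect_sum -!sum1_card big_mkcond [X in (X + _)%N]big_mkcond [X in (_ + X)%N]big_mkcond.
  rewrite -big_split /=; apply: leq_sum => w _; rewrite !inE.
  case: (boolP (w <= L)%MS) => //= wL; case: (boolP (r.+1 * q <= nf w)%N) => //= nfw.
  exact: defect_gt0 nfw.
move: H; rewrite card_compl_points (rankL Lf) /critical_defect.
have [s qs rs] := card_field_pred; move: cf; rewrite qs => cf H.
move: {H cf} (leq_trans H (leq_add cf (leqnn _))).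
rewrite subn1 /= addn1.
move: defect_sum #|full_planes| => X _.
rewrite leq_subLR addnA => H.
rewrite -(ltn_add2l (s.+1 ^ 2 + s * s.+2 * s.+1 ^ 2)); apply: leq_trans H.
have -> : (s.+1 ^ 5 = s.+1 ^ 2 + s * s.+2 * s.+1 ^ 2 + s.+1 * s.+1 ^ 3 * s)%N by ring.
rewrite ltn_add2l !mulnA ltn_pmul2r ?ltn_pmul2r //; lia.
Qed.

Section Rank3.

Hypothesis rk3 : \rank U = 3%N.

Definition polar_part := (\sum_(w in [set w : V | (w <= U)%MS && ~~ (w <= L)%MS]) defect w)%N.
Definition off_part := (\sum_(w in [set w : V | ~~ (w <= U)%MS]) defect w)%N.

Lemma split_defect : defect_sum = (polar_part + off_part)%N.
Proof.
rewrite /defect_sum (bigID (fun w : V => (w <= U)%MS)) /=; congr addn.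
  by apply: eq_bigl => w; rewrite inE andbC.
apply: eq_bigl => w; rewrite inE andb_idl //; exact: (notin_polar hp hq LX).
Qed.

Lemma card_polar_minus : #|[set w : V | (w <= U)%MS && ~~ (w <= L)%MS]| = (q ^ 3 - q ^ 2)%N.
Proof. by rewrite card_diff_points ?(line_sub_polar hp hq LX) // rk3 (rankL Lf). Qed.

Lemma polar_part_ge : ((q ^ 3 - q ^ 2) * q <= polar_part)%N.
Proof.
rewrite -card_polar_minus -sum_nat_const; apply: leq_sum => w; rewrite inE => /andP [].
exact: (polar_defect_ge hp hq hns Lf LX).
Qed.

(** The polar plane loses q and each of the q + 1 families [min_defect]. *)
Lemma no_full_coset_defect :
  (forall w, ~~ (w <= U)%MS -> ~~ full_coset r p L w) -> (critical < defect_sum)%N.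
Proof.
move=> nofull; rewrite split_defect.
have H : (#|[set w : V | ~~ (w <= U)%MS]| * (q ^ 2 * min_defect r) <= q ^ \rank U * off_part)%N.
  apply: sum_translates => [w v vU|w]; rewrite !inE ?sub_addr // => wU.
  exact: (coset_defect hp hq hns Lf LX rk3 wU (nofull w wU)).
have := polar_part_ge; move: H; rewrite card_compl_points rk3 /critical_defect.
have m1 : (0 < min_defect r)%N by rewrite leq_maxl.
have mr : (r <= min_defect r)%N by rewrite leq_maxr.
move: (min_defect r) polar_part off_part m1 mr => m X Y m1 mr.
have [s -> rs] := card_field_pred.
have -> : (s.+1 ^ 5 - s.+1 ^ 3 = s.+1 ^ 3 * (s * s.+2))%N by nia.
have -> : (s.+1 ^ 3 - s.+1 ^ 2 = s.+1 ^ 2 * s)%N by nia.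
rewrite -mulnA leq_pmul2l ?expn_gt0 // subn1 /= => HY HX.
apply: leq_trans (leq_add HX HY).
have -> : (s.+1 ^ 2 * s * s.+1 + s * s.+2 * (s.+1 ^ 2 * m) = s.+1 ^ 2 * s * (s.+1 + s.+2 * m))%N by ring.
have -> : (r.+1 * s.+1 ^ 3 * s = s.+1 ^ 2 * s * (r.+1 * s.+1))%N by ring.
rewrite ltn_pmul2l; first by nia.
by rewrite muln_gt0 expn_gt0 /=; lia.
Qed.

End Rank3.

End Alternatives.

(** * A full family of planes *)

Lemma dirder_scale_at (F : fieldType) n d (p : {mpoly F[n]}) w c u : p \is d.+1.-homog ->
  dirder p w (c *: u) = c ^+ d * dirder p w u.
Proof.
by move=> ph; rewrite -!meval_dirder_form (meval_scale _ _ (dhomog_dirder_form w ph)).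
Qed.

Lemma subn_expS k s : (s.+1 ^ k.+1 - s.+1 ^ k = s.+1 ^ k * s)%N.
Proof. by rewrite expnS mulSn addKn mulnC. Qed.

Section DefectArith.

Variables (r s nu y : nat).
Let X := (s.+1 ^ 2 * s * (r.+1 * s.+1 - nu))%N.

Let criticalE : (r.+1 * s.+1 ^ 3 * s = s.+1 ^ 2 * s * s.+1 + s.+1 * s * (s.+1 ^ 2 * r))%N.
Proof. by ring. Qed.

Let X_ge k : (k + nu <= r.+1 * s.+1)%N -> (s.+1 ^ 2 * s * k <= X)%N.
Proof.
move=> H; rewrite /X leq_mul2l; apply/orP; right.
by rewrite leq_subRL ?(leq_trans (leq_addl _ _) H) // addnC.
Qed.

(** The two summands are the defects of the polar space, where nu counts the points
  of the polar plane off the line, and of the families which are not full. *)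
Lemma critical_le : (nu <= r * s.+1)%N -> (s.+1 * s * (s.+1 ^ 2 * r) <= y)%N ->
  (r.+1 * s.+1 ^ 3 * s <= X + y)%N.
Proof. by move=> H Hy; rewrite criticalE leq_add // X_ge // mulSn leq_add2l. Qed.

Lemma critical_lt : (nu <= r * s.+1)%N -> (s.+1 * s * (s.+1 ^ 2 * r) < y)%N ->
  (r.+1 * s.+1 ^ 3 * s < X + y)%N.
Proof. by move=> H Hy; rewrite criticalE -addnS leq_add // X_ge // mulSn leq_add2l. Qed.

Lemma critical_lt_nu : (0 < s)%N -> (nu < r * s.+1)%N ->
  (s.+1 * s * (s.+1 ^ 2 * r) <= y)%N -> (r.+1 * s.+1 ^ 3 * s < X + y)%N.
Proof.
move=> s0 H Hy; rewrite criticalE -addSn leq_add //.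
apply: (@leq_trans (s.+1 ^ 2 * s * s.+2)); last by apply: X_ge; rewrite mulSn addSnnS leq_add2l.
by rewrite ltn_pmul2l // muln_gt0 expn_gt0.
Qed.

End DefectArith.

Section FullCoset.

Variables (F : finFieldType) (K : closedFieldType) (iota : {rmorphism F -> K}).
Variables (r : nat) (p : {mpoly F[5]}).
Hypotheses (hp : p \is r.+2.-homog) (hq : (r.+2 <= #|F|)%N).
Hypothesis hns : nonsingular iota p.
Local Notation q := #|F|.
Local Notation V := 'rV[F]_5.
Local Notation ev v := (p.@[fun_of_matrix v 0]).
Local Notation vanish := (vanish p).

(** The last condition says that the base of the cone has (d - 1) q + 1 points. *)
Definition cone_vertex (e : V) :=
  [/\ e != 0, ev e = 0,
      forall x : V, (x <= tangent_space p e)%MS -> forall s, ev (x + s *: e) = ev x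
    & zeros vanish (tangent_space p e) = (q * (1 + (q - 1) * (r.+1 * q + 1)))%N].

Variable L : 'M[F]_(2, 5).
Hypotheses (Lf : row_free L) (LX : forall u : V, (u <= L)%MS -> ev u = 0).

Local Notation nf w := (fiber vanish L w).
Local Notation U := (polar p L).
Local Notation defect := (defect r p L).
Local Notation defect_sum := (defect_sum r p L).
Local Notation critical := (critical_defect F r).

(** The remaining way to attain the bound: the polar plane, spanned by L and w0, meets X
  in L, counted twice, and d - 2 more lines through e, and all planes that are
  not polar have small defect. *)
Definition tight (e b w0 : V) :=
  [/\ (col_mx e b :=: L)%MS, (w0 <= U)%MS && ~~ (w0 <= L)%MS,
      forall x : V, (x <= U)%MS -> forall s, ev (x + s *: e) = ev x,
      nf w0 = (r * q)%N /\ (0 < r)%N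
    & forall w : V, ~~ (w <= U)%MS -> (defect w <= r)%N].

(** The plane through L and w0 is foliated by lines of two directions along which
  p is constant. *)
Lemma two_directions_constant (e e' w0 : V) : (e <= L)%MS -> (e' <= L)%MS ->
  e != 0 -> ~~ (e' <= e)%MS -> (w0 <= U)%MS ->
  (forall x : V, (x <= U)%MS -> forall s, ev (x + s *: e) = ev x) ->
  (forall x : V, (x <= U)%MS -> forall s, ev (x + s *: e') = ev x) ->
  nf w0 = 0%N \/ nf w0 = (q ^ 2)%N.
Proof.
move=> eL e'L e0 ee' w0U inv inv'.
have LE : (L :=: e + e')%MS by apply: rank_step => //; rewrite (rankL Lf) rank_rV e0.
have const u : (u <= L)%MS -> ev (w0 + u) = ev w0.
  rewrite LE => /sub_add_row [v /sub_rVP [s ->] [t ->]].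
  rewrite addrA inv' ?inv // addmx_sub // scalemx_sub //.
  exact: submx_trans eL (line_sub_polar hp hq LX).
have [w00|w00] := eqVneq (ev w0) 0; [right|left].
  rewrite -(cardL Lf); apply: eq_card => u; rewrite !inE.
  by case: (boolP (u <= L)%MS) => //= uL; rewrite /vanish const // w00 eqxx.
apply: eq_card0 => u; rewrite !inE.
by case: (boolP (u <= L)%MS) => //= uL; rewrite /vanish const // (negPf w00).
Qed.

Section Coset.

Hypothesis rk3 : \rank U = 3%N.
Variable w1 : V.
Hypotheses (w1U : ~~ (w1 <= U)%MS) (w1full : full_coset r p L w1).

(** Let nu be the number of points of the polar plane off L.  If nu = 0, then e is
  the required vertex and the polar plane alone has the critical defect.  If
  nu > 0, a second full family, with its own direction on L, would make p
  constant on the polar plane off L and force nu = q^2, which is too many; so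
  every other family loses [min_defect] = r.  Together with (r + 1) q - nu from
  the polar plane and nu <= r q this reaches the critical defect, and exceeds it
  unless nu = r q and no plane outside the polar space loses more than r. *)
Lemma full_coset_alternatives :
  (critical < defect_sum)%N \/ (critical <= defect_sum)%N /\
    ((exists e, cone_vertex e) \/ exists e b w0, tight e b w0).
Proof.
have [e [b [E e0 w1e inv]]] := full_coset_invariant hp hq hns Lf LX w1U w1full.
have eL : (e <= L)%MS by rewrite -E -addsmxE addsmxSl.
have TE := tangent_polar hns LX eL e0 rk3 w1U w1e.
set T := tangent_space p e in TE.
have UT : (U <= T)%MS by rewrite TE addsmxSl.
have rT : \rank T = 4%N by rewrite (rank_tangent hns e0 (LX eL)).
have LU := line_sub_polar hp hq LX.
have invT (x : V) : (x <= T)%MS -> forall s, ev (x + s *: e) = ev x.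
  by rewrite TE; apply: inv.
have invU (x : V) : (x <= U)%MS -> forall s, ev (x + s *: e) = ev x.
  by move=> xU; apply: invT; apply: submx_trans xU UT.
have nfT (x : V) : (x <= T)%MS -> ~~ (x <= U)%MS -> nf x = (r.+1 * q)%N.
  move=> xT xU; apply/eqP; rewrite eqn_leq.
  rewrite (fiber_bound hp hq hns Lf LX (rowsL L)) ?(notin_polar hp hq LX) //=.
  move: xT xU; rewrite TE => /sub_add_row [v vU [c ->]] xU.
  have c0 : c != 0 by apply: contraNneq xU => ->; rewrite scale0r addr0.
  have -> : v + c *: w1 = c *: (w1 + c^-1 *: v).
    by rewrite scalerDr scalerA mulfV // scale1r addrC.
  by rewrite (fiber_scale hp) //; apply: (forall_inP w1full); rewrite inE scalemx_sub.
have [s qs rs] := card_field_pred hq.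
have [w0] : exists w0 : V, w0 \in [set w : V | (w <= U)%MS && ~~ (w <= L)%MS].
  by apply/card_gt0P; rewrite (card_polar_minus hp hq Lf LX rk3) qs subn_expS muln_gt0 expn_gt0 /= (leq_ltn_trans _ rs).
rewrite inE => /andP [w0U w0L].
have UE : (U :=: L + w0)%MS by apply: rank_step => //; rewrite rk3 (rankL Lf).
have nfU (x : V) : (x <= U)%MS -> ~~ (x <= L)%MS -> nf x = nf w0.
  rewrite UE => /sub_add_row [v vL [c ->]] xL; rewrite addrC fiber_shift //.
  by rewrite (fiber_scale hp) //; apply: contraNneq xL => ->; rewrite scale0r addr0.
have nu_le : (nf w0 <= r * q)%N by apply: (fiber_polar_bound hp hq hns Lf LX (rowsL L) w0L w0U).
have polarE : polar_part r p L = (q ^ 2 * s * (r.+1 * q - nf w0))%N.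
  rewrite /polar_part (eq_bigr (fun=> (r.+1 * q - nf w0)%N)) => [|x]; last first.
    by rewrite inE => /andP [xU xL]; rewrite /defect nfU.
  by rewrite sum_nat_const (card_polar_minus hp hq Lf LX rk3) qs subn_expS.
have [nu0|nu0] := posnP (nf w0).
  right; split.
    rewrite (split_defect hp hq LX); apply: leq_trans (leq_addr _ _).
    by rewrite polarE nu0 subn0 /critical_defect qs subn1 /=; apply: eq_leq; ring.
  left; exists e; split=> //; first exact: LX.
  rewrite -/T; have := sum_fiber vanish (submx_trans LU UT).
  rewrite (sum_points_split _ UT) (sum_points_split _ LU).
  rewrite (eq_bigr (fun=> (q ^ 2)%N)) => [|x]; last by rewrite inE => /(fiber_in Lf LX).
  rewrite [X in (_ + X + _)%N](eq_bigr (fun=> 0%N)) => [|x]; last first.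
    by rewrite inE => /andP [xU xL]; rewrite nfU.
  rewrite [X in (_ + _ + X)%N](eq_bigr (fun=> (r.+1 * q)%N)) => [|x]; last first.
    by rewrite inE => /andP [xT xU]; apply: nfT.
  rewrite !sum_nat_const (cardL Lf) (card_diff_points UT) rk3 rT (rankL Lf).
  have -> : (q ^ 2 * q ^ 2 + #|[set w : 'rV_5 | (w <= U)%MS && ~~ (w <= L)%MS]| * 0 +
    (q ^ 4 - q ^ 3) * (r.+1 * q) = q ^ 2 * (q * (1 + (q - 1) * (r.+1 * q + 1))))%N.
    by rewrite muln0 qs subn1 subn_expS /=; ring.
  by move/eqP; rewrite eqn_pmul2l ?qs ?expn_gt0 // => /eqP.
have r0 : (0 < r)%N by case: (r) nu_le nu0 => //; case: (nf w0).
have nofull (w : V) : ~~ (w <= T)%MS -> ~~ full_coset r p L w.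
  move=> wT; apply/negP => wfull.
  have wU : ~~ (w <= U)%MS by apply: contra wT => /submx_trans; apply.
  have [e' [b' [E' e'0 we' inv']]] := full_coset_invariant hp hq hns Lf LX wU wfull.
  have e'L : (e' <= L)%MS by rewrite -E' -addsmxE addsmxSl.
  have ee' : ~~ (e' <= e)%MS.
    apply: contra wT => /sub_rVP [c ce]; rewrite sub_tangent.
    move: we' e'0; rewrite ce (dirder_scale_at _ _ _ hp) => /eqP.
    by rewrite mulf_eq0 scaler_eq0 (negPf e0) orbF expf_eq0 /= => /orP [/eqP ->|//];
      rewrite eqxx.
  have inv'U (x : V) : (x <= U)%MS -> forall s, ev (x + s *: e') = ev x.
    by move=> xU; apply: inv'; apply: submx_trans xU (addsmxSl _ _).
  have [H|H] := two_directions_constant eL e'L e0 ee' w0U invU inv'U.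
    by rewrite H in nu0.
  by move: nu_le; rewrite H expnS expn1 qs leq_pmul2r // leqNgt (leq_trans rs).
(* The families other than the full one. *)
pose S := [set w : V | ~~ (w <= T)%MS].
have SU (w v : V) : (v <= U)%MS -> (w + v \in S) = (w \in S).
  by move=> vU; rewrite !inE sub_addr //; apply: submx_trans vU UT.
have SG (w : V) : w \in S -> (q ^ 2 * min_defect r <= \sum_(v in points U) defect (w + v)%R)%N.
  rewrite inE => wT; apply: (coset_defect hp hq hns Lf LX rk3 _ (nofull w wT)).
  by apply: contra wT => /submx_trans; apply.
have cS : #|S| = (q ^ 3 * (q * s))%N.
  by rewrite card_compl_points rT qs subn_expS; ring.
have maxr : min_defect r = r by apply/maxn_idPr.
rewrite maxr in SG.
pose Y := (\sum_(w in S) defect w)%N.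
have offY : (Y <= off_part r p L)%N.
  rewrite /off_part [leqRHS](bigID (mem S)) /=; apply: leq_trans (leq_addr _ _).
  rewrite leq_eqVlt; apply/orP; left; apply/eqP/eq_bigl => w; rewrite !inE.
  by rewrite andb_idl //; apply: contra => /submx_trans; apply.
have [/existsP [w /andP [wU dw]]|] := boolP [exists w, ~~ (w <= U)%MS && (r < defect w)%N].
  left; have wT : w \in S.
    rewrite inE; apply: contraTN dw => wT.
    by rewrite /defect nfT // subnn.
  have Gw : (q ^ 2 * r < \sum_(v in points U) defect (w + v)%R)%N.
    apply: (@leq_trans (\sum_(v in points L) defect (w + v)%R)).
      rewrite (eq_bigr (fun=> defect w)) => [|u]; last by rewrite inE => /defect_shift ->.
      by rewrite sum_nat_const (cardL Lf) ltn_pmul2l // qs expn_gt0.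
    by rewrite (sum_points_split _ LU) leq_addr.
  have := sum_translates_lt SU SG wT Gw; rewrite -/Y cS rk3 (split_defect hp hq LX).
  rewrite -mulnA ltn_pmul2l ?qs ?expn_gt0 // => HY.
  rewrite /critical_defect polarE; apply: leq_trans (leq_add (leqnn _) offY).
  by move: nu_le; rewrite qs subn1 /= => nu_le; apply: critical_lt.
rewrite negb_exists => /forallP small.
have := sum_translates SU SG; rewrite -/Y cS rk3.
rewrite -mulnA leq_pmul2l ?qs ?expn_gt0 // => HY.
have {small}small (w : V) : ~~ (w <= U)%MS -> (defect w <= r)%N.
  by move=> wU; have := small w; rewrite wU /= -leqNgt.
have [nu|nu] := ltnP (nf w0) (r * q).
  left; rewrite (split_defect hp hq LX) polarE.
  apply: leq_trans (leq_add (leqnn _) offY).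
  rewrite /critical_defect qs subn1 /=; rewrite qs in nu.
  by apply: critical_lt_nu; rewrite // (leq_ltn_trans _ rs).
right; split.
  rewrite (split_defect hp hq LX) polarE.
  apply: leq_trans (leq_add (leqnn _) offY).
  rewrite /critical_defect qs subn1 /=; rewrite qs in nu_le.
  exact: critical_le.
right; exists e, b, w0; split=> //; first by rewrite w0U.
by split=> //; apply/eqP; rewrite eqn_leq nu_le.
Qed.

End Coset.

Lemma line_alternatives :
  (critical < defect_sum)%N \/ (critical <= defect_sum)%N /\
    ((exists e, cone_vertex e) \/ exists e b w0, tight e b w0).
Proof.
have := rank_polar_ge hp hq Lf LX; have := rank_polar_le hp hq hns Lf LX.
rewrite leq_eqVlt => /predU1P [rk3|le2] ge2; last first.
  left; apply: (line_polar_defect hp hq hns Lf LX).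
  by apply/eqP; rewrite eqn_leq ge2 -ltnS le2.
have [/existsP [w /andP [wU wf]]|] := boolP [exists w : V, ~~ (w <= U)%MS && full_coset r p L w].
  exact: full_coset_alternatives wU wf.
rewrite negb_exists => /forallP H; left.
apply: (no_full_coset_defect hp hq hns Lf LX rk3) => w wU.
by have := H w; rewrite wU.
Qed.

End FullCoset.

(** * Counting the rational points *)

Section Final.

Variables (F : finFieldType) (K : closedFieldType) (iota : {rmorphism F -> K}).
Variables (r : nat) (p : {mpoly F[5]}).
Hypotheses (hp : p \is r.+2.-homog) (hq : (r.+2 <= #|F|)%N).
Hypothesis hns : nonsingular iota p.
Local Notation q := #|F|.
Local Notation V := 'rV[F]_5.
Local Notation ev v := (p.@[fun_of_matrix v 0]).
Local Notation vanish := (vanish p).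
Local Notation N := #|rational_points p|.
Local Notation critical := (critical_defect F r).

Definition max_points := (r.+1 * q ^ 3 + r.+1 * q ^ 2 + q + 1)%N.

Lemma fiber_invariant (e b w : V) : row_free (col_mx e b) ->
  (forall s t, ev (w + (s *: e + t *: b)) = ev (w + t *: b)) ->
  fiber vanish (col_mx e b) w = (q * #|[set t | ev (w + t *: b) == 0%R]|)%N.
Proof.
move=> eb inv; rewrite fiber_plane // -cardsT -cardsX; apply: eq_card => x.
by rewrite !inE /vanish inv.
Qed.

(** Without defects X would exceed the bound by (d - 1) q points. *)
Lemma points_defect (L : 'M[F]_(2, 5)) : row_free L ->
  (forall u : V, (u <= L)%MS -> ev u = 0) ->
  (q ^ 2 * (q - 1) * N + defect_sum r p L = q ^ 2 * (q - 1) * max_points + critical)%N.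
Proof.
move=> Lf LX; have := total_defect hp hq hns Lf LX.
rewrite (card_cone_zeros _ hp) // /max_points /critical_defect.
have [s -> rs] := card_field_pred hq; rewrite subn1 /=.
have -> : (s.+1 ^ 5 - s.+1 ^ 2 = s.+1 ^ 2 * (s.+1 ^ 2 * s + s.+1 * s + s))%N.
  apply/eqP; rewrite -(eqn_add2r (s.+1 ^ 2)) subnK ?leq_pexp2l //; apply/eqP; ring.
move: (defect_sum _ _ _) N => D n H.
apply/eqP; rewrite -(eqn_add2l (s.+1 ^ 2)); apply/eqP.
have -> : (s.+1 ^ 2 + (s.+1 ^ 2 * s * n + D) = s.+1 ^ 2 * (s * n).+1 + D)%N by ring.
by rewrite H; ring.
Qed.

Lemma points_le (L : 'M[F]_(2, 5)) : row_free L ->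
  (forall u : V, (u <= L)%MS -> ev u = 0) -> (critical <= defect_sum r p L)%N ->
    (N <= max_points)%N.
Proof.
move=> Lf LX le; have := points_defect Lf LX; have [s -> rs] := card_field_pred hq.
move: le; move: (defect_sum _ _ _) critical N max_points => D c n b le H.
have : (s.+1 ^ 2 * (s.+1 - 1) * n <= s.+1 ^ 2 * (s.+1 - 1) * b)%N.
  by rewrite -(leq_add2r D) H leq_add2l.
by rewrite leq_pmul2l // subn1 muln_gt0 expn_gt0 (leq_ltn_trans _ rs).
Qed.

Lemma points_lt (L : 'M[F]_(2, 5)) : row_free L ->
  (forall u : V, (u <= L)%MS -> ev u = 0) -> (critical < defect_sum r p L)%N ->
    (N < max_points)%N.
Proof.
move=> Lf LX lt; rewrite ltn_neqAle (points_le Lf LX (ltnW lt)) andbT.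
apply: contraTneq lt => E; have := points_defect Lf LX; rewrite E => /addnI ->.
by rewrite ltnn.
Qed.

(** The lines through a point a: q^3 + q^2 + q + 1 of them, q^2 + q + 1 tangent. *)
Lemma no_line_points : (forall L : 'M[F]_(2, 5), row_free L ->
    exists2 u : V, (u <= L)%MS & ev u != 0) -> (N < max_points)%N.
Proof.
move=> noline; have [N0|] := posnP N; first by rewrite N0 /max_points addn1.
case/card_gt0P => M /imsetP [a]; rewrite inE => /andP [a0 /eqP pa] _.
set T := tangent_space p a.
have rT : \rank T = 4%N := rank_tangent hns a0 pa.
have aT : (a <= T)%MS by rewrite sub_tangent (dirder_self _ hp) pa mul0rn.
have ra : \rank a = 1%N by rewrite rank_rV a0.
have P0 (w : V) : ~~ (w <= a)%MS -> line_poly p w a != 0.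
  move=> wa; have [u uL] := noline _ (row_free_col_mx1 (row_free_row a0) wa).
  have [s [t ->]] := sub_col2P uL; have [->|t0] := eqVneq t 0.
    by rewrite scale0r addr0 (meval_scale _ _ hp) pa mulr0 eqxx.
  have -> : s *: a + t *: w = t *: (w + (s / t) *: a).
    by rewrite scalerDr scalerA mulrCA mulfV // mulr1 addrC.
  rewrite (meval_scale _ _ hp) -horner_line; apply: contraNneq => ->.
  by rewrite horner0 mulr0.
have fibE (w : V) : fiber vanish a w = #|[set s | (line_poly p w a).[s] == 0]|.
  by rewrite fiber_line //; apply: eq_card => s; rewrite !inE horner_line.
have sz (w : V) : (size (line_poly p w a) <= r.+2)%N.
  apply/leq_sizeP => j; rewrite leq_eqVlt => /predU1P [<-|jr].
    by rewrite (coef_line_top _ _ hp).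
  by rewrite nth_default // (leq_trans (size_line_poly _ _ hp)).
have f1 (w : V) : ~~ (w <= a)%MS -> (fiber vanish a w <= r.+1)%N.
  by move=> wa; rewrite fibE; apply: card_poly_roots (P0 w wa) (sz w).
have f2 (w : V) : (w <= T)%MS -> ~~ (w <= a)%MS -> (fiber vanish a w <= r)%N.
  move=> wT wa; rewrite fibE; apply: card_poly_roots (P0 w wa) _.
  apply/leq_sizeP => j; rewrite leq_eqVlt => /predU1P [<-|jr].
    by move: wT; rewrite sub_tangent (coef_line_subtop _ _ hp) => /eqP.
  by rewrite nth_default // (leq_trans (sz w)).
have := sum_fiber vanish (submx1 a); rewrite ra expn1.
rewrite (sum_points_split _ (submx1 T)) (sum_points_split _ aT).
have -> : zeros vanish (1%:M : 'M_5) = ((q - 1) * N).+1.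
  rewrite -(card_cone_zeros _ hp) //; apply: eq_card => v; by rewrite !inE submx1.
have S1 : (\sum_(v in points a) fiber vanish a v <= q * q)%N.
  have ca : #|points a| = q by rewrite card_points ra expn1.
  rewrite -{1}ca -sum_nat_const; apply: leq_sum => v _.
  by have := fiber_le vanish a v; rewrite ra expn1.
have S2 : (\sum_(v in [set w : V | (w <= T)%MS && ~~ (w <= a)%MS]) fiber vanish a v
           <= (q ^ 4 - q) * r)%N.
  have := card_diff_points aT; rewrite rT ra expn1 => <-.
  by rewrite -sum_nat_const; apply: leq_sum => v; rewrite inE => /andP [vT va]; apply: f2.
have S3 : (\sum_(v in [set w : V | (w <= (1%:M : 'M_5))%MS && ~~ (w <= T)%MS]) fiber vanish a v
           <= (q ^ 5 - q ^ 4) * r.+1)%N.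
  have := card_diff_points (submx1 T); rewrite rT mxrank1 => <-.
  rewrite -sum_nat_const; apply: leq_sum => v; rewrite inE => /andP [_ vT].
  by apply: f1; apply: contra vT => /submx_trans; apply.
move=> E; have := leq_add (leq_add S1 S2) S3; rewrite E.
rewrite /max_points; have [s -> rs] := card_field_pred hq.
rewrite subn_expS subn1 /=.
have -> : (s.+1 ^ 4 - s.+1 = s.+1 * (s * (s.+1 ^ 2 + s.+1 + 1)))%N.
  apply/eqP; rewrite -(eqn_add2r s.+1) subnK; last by rewrite -{1}[s.+1]expn1 leq_pexp2l.
  by apply/eqP; ring.
move: N => n; have -> : (s.+1 * s.+1 + s.+1 * (s * (s.+1 ^ 2 + s.+1 + 1)) * r + s.+1 ^ 4 * s * r.+1
  = s.+1 * (s * (1 + (s.+1 ^ 2 + s.+1 + 1) * r + s.+1 ^ 3 * r.+1)).+1)%N by ring.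
rewrite leq_pmul2l // ltnS leq_pmul2l ?(leq_ltn_trans _ rs) // => H.
apply: leq_ltn_trans H _.
have H : (s.+2 * r < s.+1 ^ 2 + s.+1)%N.
  have -> : (s.+1 ^ 2 + s.+1 = s.+2 * s.+1)%N by ring.
  by rewrite ltn_pmul2l // ltnW.
rewrite [ltnLHS](_ : _ = s.+2 * r + (s.+1 ^ 3 * r.+1 + s.+1 ^ 2 * r + 1))%N; last by ring.
rewrite [ltnRHS](_ : _ = s.+1 ^ 2 + s.+1 + (s.+1 ^ 3 * r.+1 + s.+1 ^ 2 * r + 1))%N;
  last by ring.
by rewrite ltn_add2r.
Qed.

(** Invariance under e on the tangent space says that p there depends only on the
  coordinates in a complement B, as rational values; since d <= q, this is an
  identity of polynomials.  A rational line on the base curve would span with e a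
  plane contained in X. *)
Lemma cone_vertex_section (e : V) : cone_vertex r p e ->
  exists (B : 'M[F]_(3, 5)) (g : {mpoly F[3]}),
    [/\ lies_on p e, tangent_section_is_cone_over p e B g,
        is_hypersurface r.+2 g, ~ contains_rational_line iota g
      & #|rational_points g| = (r.+1 * q + 1)%N].
Proof.
case=> e0 pe inv zT; set T := tangent_space p e in inv zT.
have rT : \rank T = 4%N := rank_tangent hns e0 pe.
have eT : (e <= T)%MS by rewrite sub_tangent (dirder_self _ hp) pe mul0rn.
(* The plane of the base curve: a complement of e in the tangent space. *)
have rD : \rank (T :\: e)%MS = 3%N.
  have := mxrank_cap_compl T e; rewrite rT (capmx_idPr eT) rank_rV e0 add1n.
  by case.
have [B Bf BE] := rank_basis rD.
have eBT : (col_mx e B :=: T)%MS.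
  have cap : (T :&: e :=: e)%MS by apply/capmx_idPr.
  apply: eqmx_trans (eqmx_sym (addsmxE e B)) _.
  apply: eqmx_trans (addsmx_diff_cap_eq T e).
  by rewrite addsmxC; apply: adds_eqmx => //; apply: eqmx_sym.
have eBf : row_free (col_mx e B) by rewrite /row_free eBT rT.
have BT (y : 'rV_3) : (y *m B <= T)%MS.
  by rewrite -eBT -addsmxE (submx_trans (submxMl _ _)) ?addsmxSr.
pose g := restrict B p.
have gE (y : 'rV_3) : g.@[y 0] = ev (y *m B) by apply: meval_restrict.
have gh : g \is r.+2.-homog by apply: dhomog_restrict.
exists B, g; split.
- by rewrite /lies_on e0 pe eqxx.
- split=> //; first by apply/eqmxP.
  exists 1; rewrite ?oner_eq0 // scale1r; apply/eqP; rewrite -subr_eq0; apply/eqP.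
  apply: (fin_form_vanishes0 hq) => [|y].
    by rewrite dhomogD ?dhomogN ?dhomog_restrict ?dhomog_cone.
  rewrite mevalB meval_restrict meval_cone gE -{1}[y]hsubmxK mul_row_col.
  by rewrite [lsubmx y]mx11_scalar mul_scalar_mx [_ *: e + _]addrC inv ?subrr.
- rewrite /is_hypersurface gh andbT; apply/eqP => g0.
  by apply: (nonsingular_no_plane hp hq hns Bf) => y; rewrite -gE g0 meval0.
- case=> L' [L'f L'g].
  have gL (y : 'rV_2) : g.@[(y *m L') 0] = 0.
    have [->|y0] := eqVneq (y *m L') 0; first exact: (meval_at0 _ gh).
    have := L'g (map_mx iota (y *m L')); rewrite map_mx_eq0 y0 => /(_ isT).
    rewrite map_submx submxMl => /(_ isT) /andP [_].
    by rewrite meval_rmorph fmorph_eq0 => /eqP.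
  have Mf : row_free (col_mx e (L' *m B)).
    apply: inj_row_free => y; rewrite -[y]hsubmxK mul_row_col mulmxA -mul_row_col => /eqP.
    rewrite mulmx_free_eq0 // => /eqP; rewrite -row_mx0 => /eq_row_mx [-> /eqP].
    by rewrite mulmx_free_eq0 // => /eqP ->; rewrite row_mx0.
  suff p0 (y : 'rV_(1 + 2)) : ev (y *m col_mx e (L' *m B)) = 0.
    exact: (nonsingular_no_plane hp hq hns Mf p0).
  rewrite -[y]hsubmxK mul_row_col mulmxA [lsubmx y]mx11_scalar mul_scalar_mx addrC.
  by rewrite inv // -gE gL.
have cg := card_cone_zeros (isT : (0 < r.+2)%N) gh.
have : zeros vanish T = muln q #|[set y : 'rV[F]_3 | g.@[y 0] == 0]|.
  pose h (x : F * 'rV[F]_3) : V := x.1 *: e + x.2 *m B.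
  have hE x : h x = row_mx x.1%:M x.2 *m col_mx e B by rewrite mul_row_col mul_scalar_mx.
  have inj : injective h.
    move=> x y; rewrite !hE => /(row_free_inj eBf) /eq_row_mx [] /rowP /(_ 0).
    by rewrite !mxE !mulr1n; case: x y => [? ?] [? ?] /= -> ->.
  rewrite -cardsT -cardsX -(card_imset _ inj); apply: eq_card => v; rewrite !inE.
  apply/andP/imsetP => [[vT /eqP pv]|[x]].
    move: vT pv; rewrite -eBT => /submxP [y ->] pv.
    exists (lsubmx y 0 0, rsubmx y); last by rewrite hE /= -mx11_scalar hsubmxK.
    rewrite !inE gE /=; move: pv; rewrite -{1}[y]hsubmxK mul_row_col addrC.
    by rewrite [lsubmx y]mx11_scalar mul_scalar_mx inv // => ->.
  rewrite !inE /= gE => /eqP px ->; rewrite hE -eBT submxMl -hE.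
  by rewrite /vanish /h addrC inv // px.
rewrite zT cg; have [s -> rs] := card_field_pred hq; rewrite subn1 /= => /eqP.
rewrite eqn_pmul2l // add1n eqSS eqn_pmul2l ?(leq_ltn_trans _ rs) // => /eqP <-.
by [].
Qed.

(** The new line joins e to a point w of the old polar plane.  In that plane the
  lines other than L are simple components, so the derivative in direction b does
  not vanish along the new line and b is not polar for it; but the plane spanned
  by b and the new line, the old polar plane, has at most (d - 2) q points off
  the new line, hence defect at least q > r. *)
Lemma tight_switch (L : 'M[F]_(2, 5)) (e b w0 : V) : row_free L ->
  (forall u : V, (u <= L)%MS -> ev u = 0) -> tight r p L e b w0 ->
  exists L' : 'M[F]_(2, 5), [/\ row_free L', forall u : V, (u <= L')%MS -> ev u = 0
    & forall e' b' w', ~ tight r p L' e' b' w'].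
Proof.
move=> Lf LX [E /andP [w0U w0L] inv [nu r0] _].
have LU := line_sub_polar hp hq LX.
(* A point of X on the polar plane off L; translating w0 along L reaches it. *)
have [u] : exists u, u \in [set u in points L | vanish (w0 + u)].
  by apply/card_gt0P; rewrite -/(fiber vanish L w0) nu muln_gt0 r0 (leq_trans _ hq).
rewrite !inE => /andP [uL /eqP pw]; set w := w0 + u in pw.
have wU : (w <= polar p L)%MS by rewrite addmx_sub // (submx_trans uL).
have wL : ~~ (w <= L)%MS by rewrite sub_addr.
have {nu}nu : fiber vanish L w = (r * q)%N by rewrite fiber_shift.
have ebf := eqmx_row_free2 Lf E.
have eL : (e <= L)%MS by rewrite -E -addsmxE addsmxSl.
have bL : (b <= L)%MS by rewrite -E -addsmxE addsmxSr.
have e0 : e != 0 := row_free_col2_neq0 ebf.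
have bU := submx_trans bL LU.
have L'f : row_free (col_mx e w).
  apply: row_free_col_mx1; first exact: row_free_row.
  by apply: contra wL => /submx_trans; apply.
have L'X (v : V) : (v <= col_mx e w)%MS -> ev v = 0.
  case/sub_col2P => s [t ->]; rewrite addrC inv ?scalemx_sub //.
  by rewrite (meval_scale _ _ hp) pw mulr0.
exists (col_mx e w); split=> // e' b' w' [_ _ _ _ small].
pose h := line_poly p w b.
(* The r lines through e other than L, by the points w + t b they pass through;
   the value 0 is the new line. *)
pose R := [set t | h.[t] == 0].
have cR : #|R| = r.
  have := fiber_invariant ebf (w := w); rewrite (eq_fiber _ _ E) nu mulnC => H.
  have : (q * r = q * #|[set t | ev (w + t *: b) == 0%R]|)%N.
    rewrite H // => s t; rewrite [s *: e + _]addrC addrA inv //.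
    by rewrite addmx_sub // scalemx_sub.
  move/eqP; rewrite eqn_pmul2l ?(leq_trans _ hq) // => /eqP ->.
  by apply: eq_card => t; rewrite !inE horner_line.
have R0 : 0 \in R by rewrite inE horner_line scale0r addr0 pw.
have cR0 : #|R :\ 0| = r.-1 by have := cardsD1 0 R; rewrite R0 cR => ->.
have bU' : ~~ (b <= polar p (col_mx e w))%MS.
  apply/negP => /sub_polarP bU'.
  have h1 : h`_1 = 0.
    have ww : (w <= col_mx e w)%MS by rewrite -addsmxE addsmxSr.
    by rewrite coef_line1 bU'.
  have h0 : h`_0 = 0 by rewrite coef_line0.
  have sh : (size h <= r.+1)%N.
    apply/leq_sizeP => j; rewrite leq_eqVlt => /predU1P [<-|].
      rewrite (coef_line_subtop _ _ hp); exact: (elimT (sub_polarP _ _ _) wU).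
    rewrite leq_eqVlt => /predU1P [<-|jr]; first by rewrite (coef_line_top _ _ hp) LX.
    by rewrite nth_default // (leq_trans (size_line_poly _ _ hp)).
  (* A double root at 0 is one root too many for the degree of h. *)
  pose h2 := drop_poly 2 h.
  have hE : h = h2 * 'X^2.
    rewrite -[LHS](poly_take_drop 2) (_ : take_poly 2 h = 0) ?add0r //.
    by apply/polyP => -[|[|j]]; rewrite coef_take_poly coef0.
  have h2n0 : h2 != 0.
    apply/negP => /eqP h20; move: cR; have -> : R = setT.
      by apply/setP => t; rewrite !inE hE h20 mul0r horner0 eqxx.
    by rewrite cardsT => qr; move: hq; rewrite qr ltnNge leqnSn.
  have sub : R :\ 0 \subset [set t | h2.[t] == 0].
    apply/subsetP => t; rewrite !inE hE hornerM hornerXn mulf_eq0 expf_eq0 /=.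
    by case/andP => /negPf ->; rewrite orbF.
  have s2 : (size h2 <= r.-1)%N by rewrite size_drop_poly leq_subLR add2n;
    case: (r) r0 sh => // k _; rewrite ltnS.
  have := max_poly_roots h2n0 (rs := enum (R :\ 0)).
  rewrite -cardE cR0 enum_uniq => /(_ _ isT) H.
  have : (r.-1 < size h2)%N.
    by apply: H; apply/allP => t; rewrite mem_enum => /(subsetP sub); rewrite inE.
  by rewrite ltnNge s2.
have := small b bU'; apply/negP; rewrite -ltnNge.
have cb : leq #|[set t | ev (b + t *: w) == 0]| r.
  have -> : r = addn 1 #|R :\ 0| by rewrite cR0 add1n prednK.
  rewrite (cardsD1 0) leq_add ?leq_b1 //.
  (* The points b + t w and w + t^-1 b are proportional. *)
  rewrite -(card_imset (mem (R :\ 0)) (can_inj (@invrK F))).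
  apply/subset_leq_card/subsetP => t; rewrite !inE => /andP [t0 /eqP bt].
  apply/imsetP; exists t^-1; rewrite ?invrK // !inE invr_eq0 t0 horner_line.
  have -> : w + t^-1 *: b = t^-1 *: (b + t *: w).
    by rewrite scalerDr scalerA mulVf // scale1r addrC.
  by rewrite (meval_scale _ _ hp) bt mulr0 eqxx.
have nb : (fiber vanish (col_mx e w) b <= r * q)%N.
  rewrite fiber_invariant // => [|s t]; first by rewrite mulnC leq_mul2r cb orbT.
  rewrite [s *: e + _]addrC addrA inv // addmx_sub // scalemx_sub //.
rewrite /defect; apply: (@leq_trans (r.+1 * q - r * q)); last exact: leq_sub2l.
by rewrite -mulnBl subSnn mul1n (leq_trans _ hq).
Qed.

Lemma rational_points_bound : (N <= max_points)%N /\
  (N = max_points -> exists e, cone_vertex r p e).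
Proof.
have [/existsP [L /andP [Lf /forall_inP LX']]|noL] :=
  boolP [exists L : 'M[F]_(2, 5), row_free L && [forall u in points L, ev u == 0]]; last first.
  have lt : (N < max_points)%N.
    apply: no_line_points => L Lf; move: noL; rewrite negb_exists => /forallP /(_ L).
    by rewrite Lf /= negb_forall => /existsP [u]; rewrite negb_imply inE => /andP []; exists u.
  by split; [apply: ltnW | move=> E; rewrite E ltnn in lt].
have LX (u : V) : (u <= L)%MS -> ev u = 0.
  by move=> uL; apply/eqP/LX'; rewrite inE.
have alt L' := @line_alternatives F K iota r p hp hq hns L'.
split=> [|E].
  by case: (alt L Lf LX) => [/ltnW|[]]; [|move=> H _; move: H]; apply: points_le.
have strict (L' : 'M[F]_(2, 5)) : row_free L' -> (forall u : V, (u <= L')%MS -> ev u = 0) ->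
    ~ (critical < defect_sum r p L')%N.
  by move=> Lf' LX'' lt; have := points_lt Lf' LX'' lt; rewrite E ltnn.
case: (alt L Lf LX) => [/(strict L Lf LX)//|[_ [//|[e [b [w0 tL]]]]]].
have [L1 [L1f L1X nt]] := tight_switch Lf LX tL.
case: (alt L1 L1f L1X) => [/(strict L1 L1f L1X)//|[_ [//|[e' [b' [w' tL']]]]]].
by case: (nt e' b' w').
Qed.

End Final.

Local Close Scope ring_scope.

Theorem theorem4p8 (F : finFieldType) (q d : nat) (hq : #|F| = q)
  (K : closedFieldType) (iota : {rmorphism F -> K}) (hK : integralRange iota)
  (hd2 : 2 <= d) (hdq : d <= q) (hne : (d, q) <> (4, 4))
  (p : {mpoly F[5]}) (hp : is_hypersurface d p) (hns : nonsingular iota p) :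
  #|rational_points p| <= (d - 1) * q ^ 3 + (d - 1) * q ^ 2 + q + 1 /\
  (#|rational_points p| = (d - 1) * q ^ 3 + (d - 1) * q ^ 2 + q + 1 ->
   exists (a : 'rV[F]_5) (B : 'M[F]_(3, 5)) (g : {mpoly F[3]}),
     [/\ lies_on p a,
         tangent_section_is_cone_over p a B g,
         is_hypersurface d g,
         ~ contains_rational_line iota g
       & #|rational_points g| = (d - 1) * q + 1]).
Proof.
case: d hd2 hdq hne hp => [|[|r]] // _ hdq _ /andP [_ hp].
rewrite subn1 /=; move: hdq; rewrite -hq => hdq.
have [le eq] := rational_points_bound hp hdq hns.
split; first exact: le.
by move=> /eq [e ce]; exists e; apply: cone_vertex_section hdq hns e ce.
Qed.
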